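(* Let $\phi:\mathbb{R}^n\to\mathbb{R}$ be continuously differentiable with $L_1$-Lipschitz gradient, and bounded below on $\mathbb{R}^n$ by a scalar $\hat\phi$. Run Algorithm 1 (described in the context) with the subexponential-noise zeroth-order oracle with constants $\epsilon_f\ge 0$, $a>0$, with the first-order oracle with constants $\epsilon_g,\kappa_{\rm eg}\ge 0$ and reliability $p_1\in[1/2,1]$, with $\|H_k\|\le\kappa_{\rm bhm}$ for all $k$, and with $r\ge 2\epsilon_f$. Let $p_0=1-2\exp(a(\epsilon_f-r/2))$. Let $C_1,C_2,C_3$ be the positive constants defined in the context. Given any $$\epsilon>\sqrt{\frac{4\epsilon_f+8/a+2r}{C_3\gamma^2C_1^2(2p_0+2p_1-3)}}+\frac{C_2}{C_1}\epsilon_g ,$$ the iterates satisfy $$\mathbb{P}\Big\{\min_{0\le k\le T-1}\|\nabla\phi(X_k)\|\le\epsilon\Big\}\ge 1-\exp\Big(-\frac{(1-\hat p_1/p_1)^2}{2}T\Big)-\exp\Big(-\frac{(1-\hat p_0/p_0)^2}{2}T\Big)-\exp\Big(-\frac a4 t\Big)$$ for any $\hat p_0$ and $\hat p_1$ such that $\hat p_0+\hat p_1\in\Big(\frac32+\frac{2\epsilon_f+4/a+r}{C_3\gamma^2(C_1\epsilon-C_2\epsilon_g)^2},\,p_0+p_1\Big]$, any $t\ge0$, and any positive integer $$T\ge\Big(\hat p_0+\hat p_1-\frac32-\frac{2\epsilon_f+4/a+r}{C_3\gamma^2(C_1\epsilon-C_2\epsilon_g)^2}\Big)^{-1}\Bi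g[\frac{\phi(x_0)-\hat\phi+t}{C_3\gamma^2(C_1\epsilon-C_2\epsilon_g)^2}+\frac12\log_\gamma\Big(\min\Big\{\frac{C_1\epsilon-C_2\epsilon_g}{\delta_0},\frac{\delta_0}{C_1\|\nabla\phi(x_0)\|-C_2\epsilon_g}\Big\}\Big)+\frac12\Big].$$
   Context: Notation: $\|\cdot\|$ is the Euclidean norm of vectors and the spectral norm of matrices; $\langle\cdot,\cdot\rangle$ is the sum of entrywise products; $\log_\gamma$ is the logarithm to base $\gamma\in(0,1)$. Subexponential-noise zeroth-order oracle: given $x\in\mathbb{R}^n$ it returns a random value $f(x,\xi^{(0)})$ whose error $e(x,\xi^{(0)})=f(x,\xi^{(0)})-\phi(x)$ satisfies $\mathbb{P}_{\xi^{(0)}}\{|e(x,\xi^{(0)})|>t\}\le\exp(a(\epsilon_f-t))$ for all $t\ge0$. First-order oracle: given $\delta^{(1)}>0$, $p_1\in[1/2,1]$ and $x\in\mathbb{R}^n$ it returns a random vector $g(x,\xi^{(1)})$ with $\mathbb{P}_{\xi^{(1)}}\{\|g(x,\xi^{(1)})-\nabla \phi(x)\|\le\epsilon_g+\kappa_{\rm eg}\delta^{(1)}\}\ge p_1$. The constants $\epsilon_g,\kappa_{\rm eg}\ge0$ are intrinsic to the oracle. Algorithm 1. Inputs: $x_0\in\mathbb{R}^n$, $\delta_0>0$, $\eta_1>0$, $\eta_2>0$, $\gamma\in(0,1)$, $r>0$, $p_1$; constants $\kappa_{\rm fcd}\in(0,1]$, $\kappa_{\rm bhm}>0$. For $k=0,1,2,\dots$: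 (1) Obtain $g_k$ from the first-order oracle with input $(\delta_k,p_1,x_k)$, and a symmetric matrix $H_k$ with $\|H_k\|\le\kappa_{\rm bhm}$; put $m_k(x_k+s)=\phi(x_k)+\langle g_k,s\rangle+\frac12\langle H_ks,s\rangle$. (2) Compute $s_k$ with $\|s_k\|\le\delta_k$ and $m_k(x_k)-m_k(x_k+s_k)\ge\frac{\kappa_{\rm fcd}}{2}\|g_k\|\min\{\|g_k\|/\|H_k\|,\delta_k\}$ (with $\|g_k\|/\|H_k\|=+\infty$ if $H_k=0$). (3) Obtain $f_k$ and $f_k^+$ from the zeroth-order oracle at $x_k$ and $x_k+s_k$, and set $\rho_k=\frac{f_k-f_k^++r}{m_k(x_k)-m_k(x_k+s_k)}$. (4) If $\rho_k\ge\eta_1$: set $x_{k+1}=x_k+s_k$ and $\delta_{k+1}=\gamma^{-1}\delta_k$ if $\|g_k\|\ge\eta_2\delta_k$, $\delta_{k+1}=\gamma\delta_k$ if $\|g_k\|<\eta_2\delta_k$. Otherwise set $x_{k+1}=x_k$, $\delta_{k+1}=\gamma\delta_k$. If $m_k(x_k)=m_k(x_k+s_k)$, the step is rejected (treated as $\rho_k<\eta_1$). Stochastic process: $X_k$, $X_k^+$, $\Delta_k$ denote the random vectors/radii with realizations $x_k$, $x_k+s_k$, $\delta_k$. The oracle guarantees hold conditionally on the past: let $\mathcal{F}_{k-1}$ be the $\sigma$-algebra generated by all oracle randomness in iterations $0,\dots,k-1$, and $\mathcal{F}'_{k-1}$ the one generated additionally by the randomness used to build the model $m_k$ at iteration $k$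 (so $X_k,\Delta_k$ are $\mathcal{F}_{k-1}$-measurable and $X_k^+$ is $\mathcal{F}'_{k-1}$-measurable). Then the random model gradient $G_k$ (realization $g_k$) satisfies $\mathbb{P}\{\|G_k-\nabla\phi(X_k)\|\le\kappa_{\rm eg}\Delta_k+\epsilon_g\mid\mathcal{F}_{k-1}\}\ge p_1$, and the absolute errors $\mathcal{E}_k$, $\mathcal{E}_k^+$ (realizations $|f_k-\phi(x_k)|$, $|f_k^+-\phi(x_k+s_k)|$) each satisfy $\mathbb{P}\{\mathcal{E}>t\mid\mathcal{F}'_{k-1}\}\le\exp(a(\epsilon_f-t))$ for all $t\ge0$. Positive constants: $$C_1=\min\Big\{\frac{(1-\eta_1)\kappa_{\rm fcd}}{L_1+\kappa_{\rm bhm}+2\kappa_{\rm eg}+(1-\eta_1)\kappa_{\rm fcd}\kappa_{\rm eg}},\frac{1}{\kappa_{\rm eg}+\eta_2}\Big\},$$ $$C_2=\max\Big\{\frac{(1-\eta_1)\kappa_{\rm fcd}+2}{L_1+\kappa_{\rm bhm}+2\kappa_{\rm eg}+(1-\eta_1)\kappa_{\rm fcd}\kappa_{\rm eg}},\frac{1}{\kappa_{\rm eg}+\eta_2}\Big\},\qquad C_3=\frac12\eta_1\eta_2\kappa_{\rm fcd}\min\Big\{\frac{\eta_2}{\kappa_{\rm bhm}},1\Big\}.$$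
   Formalization: The formal theorem also assumes p̂0 ≤ p0 and p̂1 ≤ p1 separately (the English restricts only their sum, and is false e.g. for p̂1 very negative with p̂0 > p0), and takes η1 < 1, the range in which C1 is meant to be positive. *)

(* Defs.v *)
From HB Require Import structures.
From mathcomp Require Import all_boot all_order all_algebra.
From mathcomp Require Import all_classical all_reals all_analysis.

Set Implicit Arguments.
Unset Strict Implicit.
Unset Printing Implicit Defensive.
Import Order.TTheory GRing.Theory Num.Theory.
Import numFieldNormedType.Exports.

Local Open Scope classical_set_scope.
Local Open Scope ring_scope.

Section euclidean.
Context {R : realType} {n : nat}.

Definition dotv (u v : 'cV[R]_n) : R := \sum_i u i 0 * v i 0.

(* The library norm `|u| on matrices is the max norm, hence this definition. *)
Definition enorm (u : 'cV[R]_n) : R := Num.sqrt (dotv u u).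

Definition specnorm (H : 'M[R]_n) : R :=
  sup [set enorm (H *m v) | v in [set v | enorm v <= 1]].

Definition grad (phi : 'cV[R]_n -> R) (x : 'cV[R]_n) : 'cV[R]_n :=
  \col_i 'D_(delta_mx i 0) phi x.

Definition C1_lipschitz_grad (phi : 'cV[R]_n -> R) (L : R) : Prop :=
  [/\ forall x, differentiable phi x,
      continuous (grad phi) &
      forall x y, enorm (grad phi x - grad phi y) <= L * enorm (x - y)].

End euclidean.

Section algorithm.
Context {R : realType} {n : nat}.
Variables (phi : 'cV[R]_n -> R) (x0 : 'cV[R]_n).
Variables (delta0 eta1 eta2 gamma r kfcd kbhm : R).

(* [model x g H s] is the value at x + s of the quadratic model centred at x. *)
Definition model (x g : 'cV[R]_n) (H : 'M[R]_n) (s : 'cV[R]_n) : R :=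
  phi x + dotv g s + 2^-1 * dotv (H *m s) s.

Definition pred_decrease (x g : 'cV[R]_n) (H : 'M[R]_n) (s : 'cV[R]_n) : R :=
  model x g H 0 - model x g H s.

(* min (|g| / |H|, delta), where |g| / |H| is +oo when H = 0. *)
Definition cauchy_radius (g : 'cV[R]_n) (H : 'M[R]_n) (delta : R) : R :=
  if H == 0 then delta else Num.min (enorm g / specnorm H) delta.

(* A step without model decrease is rejected, so the junk value of the ratio
   for a zero denominator plays no role. *)
Definition accepted (x g : 'cV[R]_n) (H : 'M[R]_n) (s : 'cV[R]_n)
    (f fplus : R) : bool :=
  (pred_decrease x g H s != 0) &&
  (eta1 <= (f - fplus + r) / pred_decrease x g H s).

(* One realization of the algorithm. *)
Record trust_region_run (x s g : nat -> 'cV[R]_n) (H : nat -> 'M[R]_n)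
    (f fplus delta : nat -> R) : Prop := TrustRegionRun {
  run_x0 : x 0%N = x0 ;
  run_delta0 : delta 0%N = delta0 ;
  run_hess_sym : forall k, (H k)^T = H k ;
  run_hess_bound : forall k, specnorm (H k) <= kbhm ;
  run_step : forall k, enorm (s k) <= delta k ;
  run_cauchy : forall k,
    kfcd / 2 * enorm (g k) * cauchy_radius (g k) (H k) (delta k)
      <= pred_decrease (x k) (g k) (H k) (s k) ;
  run_x : forall k, x k.+1 =
    if accepted (x k) (g k) (H k) (s k) (f k) (fplus k)
    then x k + s k else x k ;
  run_delta : forall k, delta k.+1 =
    if accepted (x k) (g k) (H k) (s k) (f k) (fplus k)
       && (eta2 * delta k <= enorm (g k))
    then gamma^-1 * delta k else gamma * delta k }.

End algorithm.

(* Below, [G : set (set Omega)] is a family of generators; the sigma-algebra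
   that is meant is <<s G >>. *)
Section conditioning.
Context d {Omega : measurableType d} {R : realType}.

Definition measurable_wrt (G : set (set Omega)) (Y : Omega -> R) : Prop :=
  measurable_fun [set: g_sigma_algebraType G] (Y : g_sigma_algebraType G -> R).

(* Entrywise, i.e. measurability for the Borel sets of the matrix space. *)
Definition mx_measurable_wrt (G : set (set Omega)) m p
    (Y : Omega -> 'M[R]_(m, p)) : Prop :=
  forall i j, measurable_wrt G (fun w => Y w i j).

Variable P : probability Omega R.

(* Z is a version of the conditional probability P (A | G). *)
Definition cond_prob (G : set (set Omega)) (A : set Omega) (Z : Omega -> R) :
    Prop :=
  [/\ measurable_wrt G Z,
      P.-integrable [set: Omega] (EFin \o Z) &
      forall B, <<s G >> B -> (\int[P]_(w in B) (Z w)%:E = P (A `&` B))%E].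

Definition cond_prob_ge (G : set (set Omega)) (A : set Omega) (c : R) : Prop :=
  exists2 Z, cond_prob G A Z & {ae P, forall w, c <= Z w}.

Definition cond_prob_le (G : set (set Omega)) (A : set Omega) (c : R) : Prop :=
  exists2 Z, cond_prob G A Z & {ae P, forall w, Z w <= c}.

End conditioning.

Section filtrations.
Context d d0 d1 {Omega : measurableType d} {Xi0 : measurableType d0}
  {Xi1 : measurableType d1}.
Variables (xi1 : nat -> Omega -> Xi1) (xi0 xi0plus : nat -> Omega -> Xi0).

Definition events_of d' (Xi : measurableType d') (xi : Omega -> Xi) :
    set (set Omega) :=
  preimage_set_system [set: Omega] xi measurable.

(* Generators of the sigma-algebra of the past F_(k-1): all the randomness of
   the iterations i < k. *)
Definition past (k : nat) : set (set Omega) :=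
  \bigcup_(i in [set i | (i < k)%N])
    (events_of (xi1 i) `|` events_of (xi0 i) `|` events_of (xi0plus i)).

(* Generators of F'_(k-1): the past and the randomness of the k-th model. *)
Definition past_model (k : nat) : set (set Omega) :=
  past k `|` events_of (xi1 k).

End filtrations.

Definition subexp_error d (Omega : measurableType d) (R : realType)
    (P : probability Omega R) (a epsf : R) (G : set (set Omega))
    (err : Omega -> R) : Prop :=
  forall t, 0 <= t ->
    cond_prob_le P G [set w | t < `|err w|] (expR (a * (epsf - t))).

Section constants.
Context {R : realType}.
Variables (L1 eta1 eta2 kfcd kbhm keg : R).

Let D := L1 + kbhm + 2 * keg + (1 - eta1) * kfcd * keg.

Definition const1 : R :=
  Num.min ((1 - eta1) * kfcd / D) (1 / (keg + eta2)).

Definition const2 : R :=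
  Num.max (((1 - eta1) * kfcd + 2) / D) (1 / (keg + eta2)).

Definition const3 : R :=
  2^-1 * eta1 * eta2 * kfcd * Num.min (eta2 / kbhm) 1.

End constants.

Definition logb {R : realType} (b x : R) : R := ln x / ln b.

(* Main.v *)
Require Import Defs.
From HB Require Import structures.
From mathcomp Require Import all_boot all_order all_algebra.
From mathcomp Require Import all_classical all_reals all_analysis.
From mathcomp Require Import measurable_realfun zify ring lra.

Set Implicit Arguments.
Unset Strict Implicit.
Unset Printing Implicit Defensive.
Import Order.TTheory GRing.Theory Num.Theory.
Import numFieldNormedType.Exports.

Local Open Scope classical_set_scope.
Local Open Scope ring_scope.

(** Put [Db = C1 eps - C2 epsg] and [h = C3 gamma^2 Db^2].  Call iteration k
    reliable if its gradient estimate meets the first-order guarantee and its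
    two function errors add up to at most r.

    Along one run ([run_bound]), as long as the gradient stays above eps: a
    reliable iteration whose radius is at most Db is successful
    ([accurate_small_step_successful]); a successful iteration whose radius
    is at least [gamma Db] lowers phi by at least h, up to the noise of that
    iteration ([run_step_decrease]).  The radii live on the geometric grid
    [delta0 gamma^Z], so with a grid point b between [gamma Db] and [Db] the
    radius performs a walk with unit steps around b.  Every move towards b is
    paid by an earlier move away from b ([level_count]), hence half of the T
    iterations, up to the initial distance, move away from b: upwards from
    above, which costs at least h of the decrease available in phi, or
    downwards from below, which needs an unreliable iteration.  If few
    iterations are unreliable and the total noise is small, T is bounded, and
    the assumed lower bound on T contradicts this ([run_reaches_accuracy]).

    It remains to bound three probabilities: too many bad gradients, too many
    iterations with large errors, and too much total noise.  All three follow
    from exponential moments and Markov's inequality.  A conditional bound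
    [P(B | G) <= q] is used in the integrated form
    [P (B `&` A) <= q * P A] for every A of the sigma-algebra generated by G,
    and it extends to nonnegative weights measurable for that sigma-algebra
    ([integral_cond_le]); the exponential of what happened so far is such a
    weight, so moments multiply along the iterations ([count_mgf_le],
    [error_mgf_le]).  The two counts then obey an Azuma-Hoeffding bound
    ([count_tail]); it has the variance proxy p^2 that the theorem asks for
    because both reliabilities are at least 1/2; for p0 this follows from
    [p0 + p1 > 3 / 2] and [p1 <= 1].  For the noise,
    integrating the subexponential tail gives
    [E exp(a (E + E') / 4) <= exp (1 + a epsf / 2)], where E and E' are the
    two absolute errors of one iteration ([error_sum_tail]). *)

(** * Euclidean and spectral norms *)

Section euclidean_norm.
Context {R : realType} {n : nat}.
Implicit Types (u v w : 'cV[R]_n) (c : R).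

Lemma dotvC u v : dotv u v = dotv v u.
Proof. by apply: eq_bigr => i _; rewrite mulrC. Qed.

Lemma dotvDl u v w : dotv (u + v) w = dotv u w + dotv v w.
Proof. by rewrite -big_split; apply: eq_bigr => i _; rewrite !mxE mulrDl. Qed.

Lemma dotvZl c u v : dotv (c *: u) v = c * dotv u v.
Proof. by rewrite mulr_sumr; apply: eq_bigr => i _; rewrite !mxE mulrA. Qed.

Lemma dotvNl u v : dotv (- u) v = - dotv u v.
Proof. by rewrite -scaleN1r dotvZl mulN1r. Qed.

Lemma dotvBl u v w : dotv (u - v) w = dotv u w - dotv v w.
Proof. by rewrite dotvDl dotvNl. Qed.

Lemma dotvDr u v w : dotv u (v + w) = dotv u v + dotv u w.
Proof. by rewrite dotvC dotvDl !(dotvC u). Qed.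

Lemma dotvZr c u v : dotv u (c *: v) = c * dotv u v.
Proof. by rewrite dotvC dotvZl dotvC. Qed.

Lemma dotv0r u : dotv u 0 = 0.
Proof. by rewrite -(scale0r 0) dotvZr mul0r. Qed.

Lemma dotv_ge0 u : 0 <= dotv u u.
Proof. by apply: sumr_ge0 => i _; rewrite -expr2 sqr_ge0. Qed.

Lemma dotv_eq0 u : dotv u u = 0 -> u = 0.
Proof.
move=> u0; apply/colP => i; rewrite mxE; apply/eqP; rewrite -sqrf_eq0 expr2.
rewrite eq_le -expr2 sqr_ge0 andbT -u0 [leRHS](bigD1 i)//= -expr2 lerDl.
by apply: sumr_ge0 => j _; rewrite -expr2 sqr_ge0.
Qed.

Lemma enorm_ge0 u : 0 <= enorm u.
Proof. exact: sqrtr_ge0. Qed.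

Lemma enorm_sqr u : enorm u ^+ 2 = dotv u u.
Proof. by rewrite sqr_sqrtr// dotv_ge0. Qed.

Lemma enormZ c u : enorm (c *: u) = `|c| * enorm u.
Proof.
by rewrite /enorm dotvZl dotvZr mulrA -expr2 sqrtrM ?sqr_ge0// sqrtr_sqr.
Qed.

Lemma enormN u : enorm (- u) = enorm u.
Proof. by rewrite -scaleN1r enormZ normrN1 mul1r. Qed.

Lemma enorm0 : enorm (0 : 'cV[R]_n) = 0.
Proof. by rewrite /enorm dotv0r sqrtr0. Qed.

Lemma enorm_eq0 u : enorm u = 0 -> u = 0.
Proof. by move=> u0; apply: dotv_eq0; rewrite -enorm_sqr u0 expr0n. Qed.

(** Cauchy-Schwarz: expand the square norm of [(v.v) u - (u.v) v]. *)
Lemma dotv_le_enorm u v : dotv u v <= enorm u * enorm v.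
Proof.
have [v0|v0] := eqVneq (dotv v v) 0.
  by rewrite (dotv_eq0 v0) dotv0r mulr_ge0 ?enorm_ge0.
have vv : 0 < dotv v v by rewrite lt_def v0 dotv_ge0.
have := dotv_ge0 (dotv v v *: u - dotv u v *: v).
rewrite dotvBl !dotvZl -!(dotvC (_ - _)) !dotvBl !dotvZl (dotvC v u).
set A := dotv u u; set B := dotv v v in vv *; set C := dotv u v.
have -> : B * (B * A - C * C) - C * (B * C - C * B) = B * (A * B - C ^+ 2).
  by ring.
rewrite pmulr_rge0// subr_ge0 => h.
rewrite (le_trans (ler_norm _))//.
rewrite -(@ler_pXn2r _ 2) ?nnegrE ?mulr_ge0 ?enorm_ge0//.
by rewrite exprMn !enorm_sqr real_normK// num_real.
Qed.

Lemma enormD u v : enorm (u + v) <= enorm u + enorm v.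
Proof.
rewrite -(@ler_pXn2r _ 2) ?nnegrE ?addr_ge0 ?enorm_ge0//.
rewrite sqrrD !enorm_sqr dotvDl !dotvDr (dotvC v u).
have := dotv_le_enorm u v; lra.
Qed.

Lemma entry_le_enorm u i : `|u i 0| <= enorm u.
Proof.
rewrite -(@ler_pXn2r _ 2) ?nnegrE ?enorm_ge0// enorm_sqr real_normK ?num_real//.
rewrite /dotv (bigD1 i)//= -expr2 lerDl.
by apply: sumr_ge0 => j _; rewrite -expr2 sqr_ge0.
Qed.

Lemma enorm_le_sum u : enorm u <= \sum_i `|u i 0|.
Proof.
rewrite -(@ler_pXn2r _ 2) ?nnegrE ?enorm_ge0 ?sumr_ge0//.
rewrite enorm_sqr expr2 mulr_suml.
apply: ler_sum => i _; rewrite -expr2 -real_normK ?num_real// expr2.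
apply: ler_wpM2l => //; rewrite (bigD1 i)//= lerDl; exact: sumr_ge0.
Qed.

Implicit Types H : 'M[R]_n.

(** [specnorm] is a supremum of reals, meaningful only once the set is known
    to be bounded; the sum of the absolute values of the entries is a bound. *)
Lemma specnorm_has_sup H :
  has_sup [set enorm (H *m v) | v in [set v | enorm v <= 1]].
Proof.
split; first by exists (enorm (H *m 0)), 0 => //=; rewrite enorm0 ler01.
exists (\sum_i \sum_j `|H i j|) => _ [v /= v1 <-].
apply: le_trans (enorm_le_sum _) _; apply: ler_sum => i _.
rewrite mxE (le_trans (ler_norm_sum _ _ _))//; apply: ler_sum => j _.
rewrite normrM -[leRHS]mulr1; apply: ler_wpM2l => //.
exact: le_trans (entry_le_enorm v j) v1.
Qed.

Lemma enorm_mulmx_le H v : enorm (H *m v) <= specnorm H * enorm v.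
Proof.
have [v0|v0] := eqVneq (enorm v) 0.
  by rewrite (enorm_eq0 v0) mulmx0 enorm0 mulr0.
have vp : 0 < enorm v by rewrite lt_def v0 enorm_ge0.
have : enorm (H *m ((enorm v)^-1 *: v)) <= specnorm H.
  apply: ub_le_sup; first by have [] := specnorm_has_sup H.
  exists ((enorm v)^-1 *: v) => //=.
  by rewrite enormZ ger0_norm ?invr_ge0 ?enorm_ge0// mulVf.
rewrite -scalemxAr enormZ ger0_norm ?invr_ge0 ?enorm_ge0//.
by rewrite ler_pdivrMl// mulrC.
Qed.

Lemma specnorm_gt0 H : H != 0 -> 0 < specnorm H.
Proof.
move=> H0; rewrite ltNge; apply: contra H0 => H0; apply/eqP/matrixP => i j.
rewrite !mxE; have : enorm (H *m delta_mx j 0) <= 0.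
  apply: le_trans (enorm_mulmx_le _ _) _.
  by rewrite mulr_le0_ge0// enorm_ge0.
move=> h; have /enorm_eq0 : enorm (H *m delta_mx j 0) = 0.
  by apply/eqP; rewrite eq_le h enorm_ge0.
rewrite -colE => /matrixP /(_ i 0); by rewrite !mxE.
Qed.

Lemma quadratic_form_ge H v : - (specnorm H * enorm v ^+ 2) <= dotv (H *m v) v.
Proof.
rewrite lerNl -dotvNl; apply: le_trans (dotv_le_enorm _ _) _.
rewrite enormN expr2 mulrA.
by apply: ler_wpM2r; [exact: enorm_ge0|exact: enorm_mulmx_le].
Qed.

End euclidean_norm.

(** * One iteration of the algorithm *)

Section descent.
Context {R : realType} {n : nat}.
Variables (phi : 'cV[R]_n -> R) (L : R).
Hypothesis phiL : C1_lipschitz_grad phi L.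

Lemma derive_grad (x s : 'cV[R]_n) : 'D_s phi x = dotv (grad phi x) s.
Proof.
have [dphi _ _] := phiL.
rewrite deriveE//.
have -> : s = \sum_i s i 0 *: delta_mx i 0.
  rewrite [LHS]matrix_sum_delta; apply: eq_bigr => i _.
  by rewrite big_ord1.
rewrite linear_sum; apply: eq_bigr => i _.
rewrite linearZ /= /grad mxE deriveE// mulrC; congr (_ * _).
rewrite summxE (bigD1 i)//= !mxE !eqxx mulr1 big1 ?addr0// => j ji.
by rewrite !mxE eq_sym (negbTE ji) mulr0.
Qed.

Lemma is_derive_along (x s : 'cV[R]_n) (t : R) :
  is_derive t 1 (fun t : R => phi (x + t *: s))
    (dotv (grad phi (x + t *: s)) s).
Proof.
have [dphi _ _] := phiL.
rewrite -derive_grad.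
have E : (fun h : R => h^-1 *:
    (((fun t : R => phi (x + t *: s)) \o shift t) (h *: (1 : R)) -
     phi (x + t *: s))) =
  (fun h : R => h^-1 *:
    ((phi \o shift (x + t *: s)) (h *: s) - phi (x + t *: s))).
  apply/funext => h /=; congr (_ *: (phi _ - _)).
  by rewrite (_ : h *: (1 : R) = h) ?scalerDl 1?addrCA//; exact: mulr1.
have dv : derivable phi (x + t *: s) s by exact: diff_derivable.
split; first by rewrite /derivable E.
by rewrite /derive E.
Qed.

(** The difference of the two sides along the segment from x to [x + s] is
    nonincreasing, because the gradient is Lipschitz. *)
Lemma descent (x s : 'cV[R]_n) :
  phi (x + s) <= phi x + dotv (grad phi x) s + L / 2 * enorm s ^+ 2.
Proof.
have [_ _ lip] := phiL.
pose f (t : R) : R := phi (x + t *: s) -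
  (t * dotv (grad phi x) s + L / 2 * enorm s ^+ 2 * t ^+ 2).
pose df (t : R) := dotv (grad phi (x + t *: s)) s -
  (dotv (grad phi x) s + L * enorm s ^+ 2 * t).
have fd (t : R) : is_derive t 1 f (df t).
  have := is_derive_along x s t => h.
  rewrite /f; apply: is_derive_eq.
  by rewrite /df /GRing.scale /=; field.
have : f 1 <= f 0.
  apply: (@ler0_derive1_le_cc _ f 0 1) => //; rewrite ?in_itv/= ?lexx ?ler01//.
  - move=> t; rewrite in_itv/= => /andP[t0 t1].
    rewrite derive1E derive_val /df opprD addrA -dotvBl subr_le0.
    apply: le_trans (dotv_le_enorm _ _) _.
    rewrite expr2 mulrA -[leRHS]mulrA (mulrC _ t) mulrA.
    apply: ler_wpM2r; first exact: enorm_ge0.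
    have := lip (x + t *: s) x.
    have -> : x + t *: s - x = t *: s by rewrite addrC addKr.
    by rewrite enormZ gtr0_norm// (mulrC t) mulrA.
  - apply: continuous_subspaceT => t; apply: differentiable_continuous.
    by apply/derivable1_diffP; exact: ex_derive.
rewrite /f scale1r scale0r addr0 !mul1r expr1n mul0r expr0n/= mulr0.
rewrite !addr0 subr0 mulr1.
by rewrite lerBlDr addrA.
Qed.
End descent.

Section trial_step.
Context {R : realType} {n : nat}.
Variables (phi : 'cV[R]_n -> R) (L1 : R).
Hypotheses (L1_ge0 : 0 <= L1) (phiL : C1_lipschitz_grad phi L1).
Variables (eta1 eta2 r kfcd kbhm epsg keg : R).
Hypotheses (heta1 : 0 < eta1 < 1) (heta2 : 0 < eta2) (hkfcd : 0 < kfcd <= 1).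
Hypotheses (hkbhm : 0 < kbhm) (hepsg : 0 <= epsg) (hkeg : 0 <= keg).
Variables (x g s : 'cV[R]_n) (H : 'M[R]_n) (f fplus delta : R).
Hypotheses (delta_gt0 : 0 < delta) (Hbound : specnorm H <= kbhm).
Hypothesis s_le : enorm s <= delta.
Hypothesis cauchy : kfcd / 2 * enorm g * cauchy_radius g H delta
  <= pred_decrease phi x g H s.

Local Notation C1 := (const1 L1 eta1 eta2 kfcd kbhm keg).
Local Notation C2 := (const2 L1 eta1 eta2 kfcd kbhm keg).
Local Notation C3 := (const3 eta1 eta2 kfcd kbhm).
Local Notation pred := (pred_decrease phi x g H s).

Lemma pred_decreaseE : pred = - dotv g s - 2^-1 * dotv (H *m s) s.
Proof. by rewrite /pred_decrease /model mulmx0 !dotv0r; ring. Qed.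

Lemma cauchy_radius_ge :
  Num.min (enorm g / kbhm) delta <= cauchy_radius g H delta.
Proof.
rewrite /cauchy_radius; case: eqVneq => [_|H0]; first by rewrite ge_min lexx orbT.
rewrite le_min ge_min [X in _ && X]ge_min lexx orbT andbT; apply/orP; left.
apply: ler_wpM2l; first exact: enorm_ge0.
by rewrite lef_pV2 ?posrE ?specnorm_gt0.
Qed.

Lemma cauchy_radius_ge0 : 0 <= cauchy_radius g H delta.
Proof.
apply: le_trans cauchy_radius_ge.
by rewrite le_min divr_ge0 ?enorm_ge0 ?(ltW hkbhm) ?(ltW delta_gt0).
Qed.

Lemma pred_decrease_ge0 : 0 <= pred.
Proof.
have /andP[k0 _] := hkfcd.
apply: le_trans cauchy; rewrite !mulr_ge0 ?enorm_ge0 ?cauchy_radius_ge0//.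
exact: ltW.
Qed.

(** For an accurate gradient and a radius that is small compared with the true
    gradient, the model gradient dominates both [eta2 delta] and
    [kbhm delta]; then the Cauchy decrease is proportional to
    [enorm g * delta], while the model error is at most of the order of
    [(epsg + delta) * delta].  [C1] and [C2] are chosen to make the latter at
    most the fraction [1 - eta1] of the former. *)
Lemma accurate_small_step_successful :
  enorm (g - grad phi x) <= keg * delta + epsg ->
  `|f - phi x| + `|fplus - phi (x + s)| <= r ->
  delta <= C1 * enorm (grad phi x) - C2 * epsg ->
  accepted phi eta1 r x g H s f fplus && (eta2 * delta <= enorm g).
Proof.
move=> gacc facc small.
have hL := L1_ge0; have hb := hkbhm; have hk := hkeg; have he := hepsg.
have h2 := heta2; have hd := delta_gt0.
have /andP[e1 e2] := heta1; have /andP[k1 k2] := hkfcd.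
set b := enorm (grad phi x) in small *; have b0 : 0 <= b by exact: enorm_ge0.
have bg : b <= enorm g + (keg * delta + epsg).
  have := enormD g (grad phi x - g); rewrite subrKC -[enorm (_ - g)]enormN opprB.
  by move=> /le_trans; apply; rewrite lerD2l.
have [K KE] : exists K : R, K = (1 - eta1) * kfcd by exists ((1 - eta1) * kfcd).
have K0 : 0 < K by rewrite KE mulr_gt0//; lra.
have K1 : K <= 1 by rewrite KE -[1]mulr1 ler_pM//; lra.
pose D : R := L1 + kbhm + 2 * keg + K * keg.
have Kk : 0 <= K * keg by rewrite mulr_ge0// ltW.
have D0 : 0 < D by rewrite /D; lra.
have smallD : delta * D <= K * b - (K + 2) * epsg.
  rewrite -ler_pdivlMr// mulrBl; apply: le_trans small _.
  apply: lerB; rewrite mulrAC.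
    by apply: ler_wpM2r => //; rewrite /const1 -KE -/D ge_min lexx.
  by apply: ler_wpM2r => //; rewrite /const2 -KE -/D le_max lexx.
have smallk : delta * (keg + eta2) <= b - epsg.
  have ke : 0 < keg + eta2 by lra.
  rewrite -ler_pdivlMr// mulrBl; apply: le_trans small _.
  apply: lerB; rewrite [_ / _]mulrC -[_^-1]mul1r; apply: ler_wpM2r => //.
    by rewrite /const1 ge_min lexx orbT.
  by rewrite /const2 le_max lexx orbT.
have g_large : eta2 * delta <= enorm g by lra.
rewrite g_large andbT.
have Kg : delta * (L1 + kbhm + 2 * keg) + 2 * epsg <= K * enorm g.
  have : K * b <= K * (enorm g + (keg * delta + epsg)).
    by apply: ler_wpM2l => //; exact: ltW.
  by move: smallD; rewrite /D; lra.
have dL : 0 <= delta * L1 by rewrite mulr_ge0// ltW.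
have dk : 0 <= delta * keg by rewrite mulr_ge0// ltW.
have g_hess : kbhm * delta <= enorm g.
  have : K * enorm g <= 1 * enorm g by apply: ler_wpM2r => //; exact: enorm_ge0.
  lra.
have radius : delta <= cauchy_radius g H delta.
  apply: le_trans cauchy_radius_ge.
  by rewrite le_min lexx andbT ler_pdivlMr// mulrC.
have g0 : 0 < enorm g by apply: lt_le_trans g_hess; rewrite mulr_gt0.
have predL : kfcd / 2 * enorm g * delta <= pred.
  apply: le_trans cauchy; apply: ler_wpM2l => //.
  by rewrite mulr_ge0 ?enorm_ge0//; lra.
have pred0 : 0 < pred by apply: lt_le_trans predL; rewrite !mulr_gt0//; lra.
rewrite /accepted gt_eqF//= ler_pdivlMr//.
have s0 := enorm_ge0 s.
have ss : enorm s ^+ 2 <= delta * delta by rewrite expr2 ler_pM.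
have desc := descent phiL x s.
have quad := quadratic_form_ge H s.
have HS : specnorm H * enorm s ^+ 2 <= kbhm * (delta * delta).
  apply: le_trans (_ : _ <= kbhm * enorm s ^+ 2) _.
    by apply: ler_wpM2r => //; exact: sqr_ge0.
  by apply: ler_wpM2l => //; exact: ltW.
have LS : L1 / 2 * enorm s ^+ 2 <= L1 / 2 * (delta * delta).
  by apply: ler_wpM2l => //; lra.
have gs : dotv (grad phi x - g) s <= (keg * delta + epsg) * delta.
  apply: le_trans (dotv_le_enorm _ _) _; apply: ler_pM; rewrite ?enorm_ge0//.
  by rewrite -enormN opprB.
have predK : (delta * (L1 + kbhm + 2 * keg) + 2 * epsg) * delta / 2 <=
    (1 - eta1) * pred.
  apply: le_trans (_ : _ <= (1 - eta1) * (kfcd / 2 * enorm g * delta)) _.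
    have -> : (1 - eta1) * (kfcd / 2 * enorm g * delta) =
      K * enorm g * delta / 2.
      by rewrite KE; field.
    by rewrite ler_pM2r ?invr_gt0// ler_pM2r.
  by apply: ler_wpM2l => //; lra.
move: predK; rewrite [in X in _ <= X -> _]mulrBl mul1r {1}pred_decreaseE => predK.
have f1 := ler_norm (- (f - phi x)); rewrite normrN in f1.
have f2 := ler_norm (fplus - phi (x + s)).
by rewrite dotvBl in gs; lra.
Qed.

Lemma accepted_decrease : accepted phi eta1 r x g H s f fplus ->
  eta1 * pred <= phi x - phi (x + s) +
    (`|f - phi x| + `|fplus - phi (x + s)| + r).
Proof.
move=> /andP[p0 ]; have pred0 : 0 < pred by rewrite lt_def p0 pred_decrease_ge0.
rewrite ler_pdivlMr// => h.
have h1 := ler_norm (f - phi x).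
have h2 := ler_norm (- (fplus - phi (x + s))); rewrite normrN in h2; lra.
Qed.

Lemma successful_pred_decrease : eta2 * delta <= enorm g ->
  C3 * delta ^+ 2 <= eta1 * pred.
Proof.
have /andP[e1 e2] := heta1; have /andP[k1 k2] := hkfcd; have h2 := heta2.
move=> g_large; pose m := Num.min (eta2 / kbhm) 1.
have m0 : 0 <= m by rewrite /m le_min divr_ge0 ?ltW.
have mr : m * delta <= cauchy_radius g H delta.
  apply: le_trans cauchy_radius_ge; rewrite le_min; apply/andP; split.
    apply: le_trans (_ : eta2 / kbhm * delta <= _).
      by apply: ler_wpM2r; [exact: ltW|rewrite /m ge_min lexx].
    by rewrite mulrAC ler_pM2r ?invr_gt0.
  rewrite -[leRHS]mul1r; apply: ler_wpM2r; first exact: ltW.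
  by rewrite /m ge_min lexx orbT.
have -> : C3 * delta ^+ 2 = eta1 * (kfcd / 2 * (eta2 * delta) * (m * delta)).
  by rewrite /const3 -/m; field.
apply: ler_wpM2l; first exact: ltW.
apply: le_trans cauchy; apply: ler_pM => //.
- by rewrite !mulr_ge0//; exact: ltW.
- by rewrite mulr_ge0// ltW.
- by apply: ler_wpM2l => //; lra.
Qed.

End trial_step.

(** * The radius as a walk on a geometric grid *)

Section levels.
Context {R : realType}.

(** A walk on the integers with steps 1 and -1.  The distance [`|l T|] grows
    by one at the steps counted on the right-hand side and shrinks by one at
    all others, so at most half of the steps, up to the initial distance, are
    not counted. *)
Lemma level_count (up : nat -> bool) (l : nat -> int) :
  (forall k, l k.+1 = if up k then l k + 1 else l k - 1) ->
  forall T, (T + `|l T| <=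
    (\sum_(k < T) (up k && (0 <= l k)%R)).*2 +
    (\sum_(k < T) (~~ up k && (l k <= 0)%R)).*2 + `|l 0|)%N.
Proof.
move=> lS; elim=> [|T IH]; first by rewrite !big_ord0.
rewrite !big_ord_recr /= lS; move: IH.
set A := (\sum_(k < T) _)%N; set B := (\sum_(k < T) _)%N.
case: (up T) => /=; case: lerP => ? IH; lia.
Qed.

Lemma exprz_expR (x : R) (j : int) : 0 < x -> x ^ j = expR (j%:~R * ln x).
Proof.
move=> x0; rewrite -[x in LHS]lnK ?posrE//; case: j => n.
  by rewrite -exprnP -pmulrn expRM_natl.
by rewrite NegzE -exprnN mulrNz mulNr expRN -pmulrn expRM_natl.
Qed.

(** The grid point between [gamma * Db] and [Db] is reached from delta0 in
    [ceil (log_gamma (Db / delta0))] steps.  When this number is negative,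
    its absolute value is at most [log_gamma (delta0 / Db)], and M may be put
    in place of Db because [log_gamma] decreases. *)
Lemma initial_level (gamma delta0 Db M : R) :
  0 < gamma < 1 -> 0 < delta0 -> 0 < Db -> Db <= M ->
  exists j : int, [/\ delta0 * gamma ^ j <= Db,
    gamma * Db < delta0 * gamma ^ j &
    `|j|%N%:R < logb gamma (Num.min (Db / delta0) (delta0 / M)) + 1].
Proof.
move=> /andP[g0 g1] d0 Db0 DbM.
have M0 : 0 < M by exact: lt_le_trans DbM.
have lg : ln gamma < 0 by rewrite ln_lt0// g0.
pose A := Db / delta0.
have A0 : 0 < A by rewrite divr_gt0.
have B0 : 0 < delta0 / M by rewrite divr_gt0.
pose Lg := ln A / ln gamma; pose j := Num.ceil Lg.
have jL : Lg <= j%:~R by exact: ceil_ge.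
have jL1 : j%:~R < Lg + 1.
  by rewrite -ltrBlDr; have := ceilB1_lt Lg; rewrite intrB.
have ljA : j%:~R * ln gamma <= ln A by rewrite -ler_ndivrMr.
have logb_mono (a b : R) : 0 < a -> a <= b -> logb gamma b <= logb gamma a.
  move=> a0 ab; rewrite /logb ler_nM2r ?invr_lt0//.
  by rewrite ler_ln ?posrE//; exact: lt_le_trans ab.
have min0 : 0 < Num.min A (delta0 / M) by rewrite lt_min A0.
have logA : Lg <= logb gamma (Num.min A (delta0 / M)).
  by apply: logb_mono => //; rewrite ge_min lexx.
have logB : - Lg <= logb gamma (Num.min A (delta0 / M)).
  apply: (@le_trans _ _ (logb gamma (delta0 / M))); last first.
    by apply: logb_mono => //; rewrite ge_min lexx orbT.
  have -> : - Lg = logb gamma (delta0 / Db).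
    by rewrite /logb /Lg -mulNr -lnV ?posrE// /A invf_div.
  by apply: logb_mono => //; apply: ler_wpM2l; rewrite ?(ltW d0)// lef_pV2 ?posrE.
exists j; split.
- by rewrite mulrC -ler_pdivlMr// exprz_expR// -[leRHS]lnK ?posrE// ler_expR.
- have -> : gamma * Db = delta0 * (gamma * A).
    by rewrite /A; field; rewrite gt_eqF.
  have -> : gamma * A = expR (ln gamma + ln A) by rewrite expRD !lnK ?posrE.
  rewrite ltr_pM2l// exprz_expR// ltr_expR.
  have -> : ln gamma + ln A = (Lg + 1) * ln gamma.
    by rewrite /Lg mulrDl mul1r divfK ?lt_eqF// addrC.
  by rewrite ltr_nM2r.
- case: (lerP 0 j) => j0.
    have -> : `|j|%N%:R = j%:~R :> R by rewrite pmulrn gez0_abs.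
    by apply: lt_le_trans jL1 _; rewrite lerD2r.
  have -> : `|j|%N%:R = - j%:~R :> R.
    by rewrite pmulrn ltz0_abs// mulrNz.
  apply: (@le_lt_trans _ _ (- Lg)); first by rewrite lerN2.
  by apply: (le_lt_trans logB); rewrite ltrDl.
Qed.
End levels.

(** * A whole run *)

Section run.
Context {R : realType} {n : nat}.
Variables (phi : 'cV[R]_n -> R) (L1 phihat : R).
Hypotheses (hL1 : 0 <= L1) (phiL : C1_lipschitz_grad phi L1).
Hypothesis hphihat : forall x, phihat <= phi x.
Variables (x0 : 'cV[R]_n) (delta0 eta1 eta2 gamma r kfcd kbhm epsg keg : R).
Hypotheses (hdelta0 : 0 < delta0) (heta1 : 0 < eta1 < 1) (heta2 : 0 < eta2).
Hypotheses (hgamma : 0 < gamma < 1).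
Hypotheses (hkfcd : 0 < kfcd <= 1) (hkbhm : 0 < kbhm).
Hypotheses (hepsg : 0 <= epsg) (hkeg : 0 <= keg) (hr : 0 <= r).
Variables (x s g : nat -> 'cV[R]_n) (H : nat -> 'M[R]_n).
Variables (f fplus delta : nat -> R).
Hypothesis hrun : trust_region_run phi x0 delta0 eta1 eta2 gamma r kfcd kbhm
  x s g H f fplus delta.

Local Notation C1 := (const1 L1 eta1 eta2 kfcd kbhm keg).
Local Notation C2 := (const2 L1 eta1 eta2 kfcd kbhm keg).
Local Notation C3 := (const3 eta1 eta2 kfcd kbhm).

Let up k := accepted phi eta1 r (x k) (g k) (H k) (s k) (f k) (fplus k)
  && (eta2 * delta k <= enorm (g k)).

Lemma const1_gt0 : 0 < C1.
Proof.
have /andP[e1 e2] := heta1; have /andP[k1 k2] := hkfcd.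
have h1 := hL1; have h2 := hkbhm; have h3 := hkeg; have h4 := heta2.
have h5 : 0 <= (1 - eta1) * kfcd * keg by rewrite !mulr_ge0//; lra.
rewrite /const1 lt_min; apply/andP; split; apply: divr_gt0 => //; try lra.
by rewrite mulr_gt0//; lra.
Qed.

Lemma const3_gt0 : 0 < C3.
Proof.
have /andP[e1 e2] := heta1; have /andP[k1 k2] := hkfcd.
rewrite /const3 !mulr_gt0 ?invr_gt0 ?ltr0n//.
by rewrite lt_min divr_gt0 ?ltr01.
Qed.

Lemma run_delta_gt0 k : 0 < delta k.
Proof.
have /andP[g0 g1] := hgamma.
elim: k => [|k IH]; first by rewrite (run_delta0 hrun).
by rewrite (run_delta hrun); case: ifP => _; rewrite mulr_gt0 ?invr_gt0.
Qed.

(** The position of the radius relative to the grid point [delta0 * gamma ^ j],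
    counted upwards; the walk starts at j because the radius starts at
    delta0. *)
Fixpoint level (j : int) k : int :=
  if k is k'.+1 then if up k' then level j k' + 1 else level j k' - 1 else j.

Lemma delta_level (j : int) k : delta k = delta0 * gamma ^ (j - level j k).
Proof.
have /andP[g0 g1] := hgamma; have gn0 : gamma != 0 by rewrite gt_eqF.
elim: k => [|k IH] /=; first by rewrite subrr expr0z mulr1 (run_delta0 hrun).
rewrite (run_delta hrun) -/(up k) IH; case: (up k).
  by rewrite opprD addrA [in RHS]expfzDr// mulrC -mulrA.
by rewrite opprB (addrC 1) addrA [in RHS]expfzDr// mulrC -mulrA expr1z.
Qed.

Let err k := `|f k - phi (x k)| + `|fplus k - phi (x k + s k)|.

(** Every accepted step has [f - fplus + r >= 0], hence the objective never
    increases by more than the errors and r; rejected steps do not move. *)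
Lemma run_step_decrease (b h : R) k :
  0 <= b -> h = C3 * b ^+ 2 ->
  h * (up k && (b <= delta k))%:R <= phi (x k) - phi (x k.+1) + (err k + r).
Proof.
move=> b0 hE; have dk := run_delta_gt0 k.
have /andP[e1 e2] := heta1.
have err0 : 0 <= err k + r by rewrite !addr_ge0.
have Hk := run_hess_bound hrun k; have cauchy := run_cauchy hrun k.
have pred0 := pred_decrease_ge0 hkfcd hkbhm dk Hk cauchy.
rewrite (run_x hrun) /up.
case acc: (accepted _ _ _ _ _ _ _ _ _); last by rewrite /= mulr0 subrr add0r.
have dec := accepted_decrease hkfcd hkbhm dk Hk cauchy acc.
apply: le_trans dec.
case: (boolP (_ <= enorm _)) => [gl|_] /=; last first.
  by rewrite mulr0 mulr_ge0// ltW.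
case: (boolP (b <= _)) => [bd|_]; last by rewrite mulr0 mulr_ge0// ltW.
rewrite mulr1 hE.
apply: le_trans
  (successful_pred_decrease heta1 heta2 hkfcd hkbhm dk Hk cauchy gl).
apply: ler_wpM2l; first exact/ltW/const3_gt0.
by apply: lerXn2r; rewrite ?nnegrE// ltW.
Qed.

Let accurate k := enorm (g k - grad phi (x k)) <= keg * delta k + epsg.
Let small_err k := err k <= r.

(** [level_count] applied around the grid point [delta0 * gamma ^ j].  Counted
    moves upwards lower phi by at least h, which bounds their number through
    telescoping; counted moves downwards start from a radius at most
    [C1 * eps - C2 * epsg], so at those iterations the gradient
    estimate is inaccurate or the errors exceed r. *)
Lemma run_bound (eps : R) (j : int) (T : nat) :
  0 < C1 * eps - C2 * epsg ->
  (forall k, (k < T)%N -> eps < enorm (grad phi (x k))) ->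
  delta0 * gamma ^ j <= C1 * eps - C2 * epsg ->
  gamma * (C1 * eps - C2 * epsg) < delta0 * gamma ^ j ->
  C3 * gamma ^+ 2 * (C1 * eps - C2 * epsg) ^+ 2 *
    (T%:R / 2 - \sum_(k < T) (~~ accurate k)%:R
      - \sum_(k < T) (~~ small_err k)%:R - `|j|%N%:R / 2) <=
  phi x0 - phihat + \sum_(k < T) err k + T%:R * r.
Proof.
set Db := C1 * eps - C2 * epsg => Db0 large jle jgt.
have /andP[g0 g1] := hgamma.
pose h := C3 * gamma ^+ 2 * Db ^+ 2.
have h0 : 0 <= h.
  by rewrite /h mulr_ge0 ?sqr_ge0// mulr_ge0 ?sqr_ge0// ltW// const3_gt0.
pose l := level j.
have lS k : l k.+1 = if up k then l k + 1 else l k - 1 by [].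
have cnt := level_count lS T.
have delta_ge k : 0 <= l k -> delta0 * gamma ^ j <= delta k.
  move=> lk; rewrite (delta_level j) -/(l k); apply: ler_wpM2l; first exact: ltW.
  rewrite !exprz_expR// ler_expR.
  by rewrite ler_nM2r ?ln_lt0 ?g0// ler_int lerBlDr lerDl.
have delta_le k : l k <= 0 -> delta k <= delta0 * gamma ^ j.
  move=> lk; rewrite (delta_level j) -/(l k); apply: ler_wpM2l; first exact: ltW.
  rewrite !exprz_expR// ler_expR.
  by rewrite ler_nM2r ?ln_lt0 ?g0// ler_int lerBrDr gerDl.
pose U := (\sum_(k < T) (up k && (0 <= l k)%R))%N.
pose D := (\sum_(k < T) (~~ up k && (l k <= 0)%R))%N.
have Dle : D%:R <= \sum_(k < T) (~~ accurate k)%:R +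
    \sum_(k < T) (~~ small_err k)%:R :> R.
  rewrite /D natr_sum -big_split; apply: ler_sum => k _ /=.
  rewrite -natrD ler_nat.
  case acc: (accurate k) => /=; last exact: leq_trans (leq_b1 _) _.
  case se: (small_err k) => /=; last exact: leq_b1.
  rewrite leqn0 eqb0 negb_and negbK; apply/orP.
  have [lk|lk] := leP (l k) 0; last by right.
  left; apply: (accurate_small_step_successful hL1 phiL heta1 heta2 hkfcd hkbhm
    hepsg hkeg (run_delta_gt0 k) (run_hess_bound hrun k) (run_step hrun k)
    (run_cauchy hrun k) acc se).
  apply: le_trans (delta_le _ lk) _; apply: le_trans jle _.
  rewrite lerD2r; apply: ler_wpM2l; first exact/ltW/const1_gt0.
  exact/ltW/large.
have Ule : h * U%:R <= phi x0 - phi (x T) + \sum_(k < T) (err k + r).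
  rewrite /U natr_sum mulr_sumr.
  have -> : phi x0 - phi (x T) = \sum_(k < T) (phi (x k) - phi (x k.+1)).
    rewrite -[RHS]opprK -sumrN; under eq_bigr do rewrite opprB.
    rewrite -(big_mkord xpredT (fun k => phi (x k.+1) - phi (x k))).
    by rewrite telescope_sumr// opprB (run_x0 hrun).
  rewrite -big_split; apply: ler_sum => k _ /=.
  have hE : h = C3 * (gamma * Db) ^+ 2 by rewrite /h; ring.
  have gD0 : 0 <= gamma * Db by rewrite mulr_ge0// ltW.
  apply: le_trans (run_step_decrease k gD0 hE).
  apply: ler_wpM2l => //; rewrite ler_nat.
  case: (up k) => //=; case: (leP 0 (l k)) => //= lk.
  by rewrite (le_trans (ltW jgt))// delta_ge.
have cntR : T%:R <= U%:R * 2 + D%:R * 2 + `|j|%N%:R :> R.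
  rewrite -!natrM -!natrD ler_nat; move: cnt; rewrite -/U -/D -!muln2 /l /=.
  by apply: leq_trans; rewrite leq_addr.
have : h * (T%:R / 2 - \sum_(k < T) (~~ accurate k)%:R -
    \sum_(k < T) (~~ small_err k)%:R - `|j|%N%:R / 2) <= h * U%:R.
  by apply: ler_wpM2l => //; lra.
move=> /le_trans; apply; apply: le_trans Ule _.
rewrite big_split /= sumr_const card_ord -mulr_natl.
have := hphihat (x T); lra.
Qed.

(** If the gradient exceeded eps at every iterate, it would do so at x0, and
    the argument of the logarithm would be positive.  The summand [2^-1]
    in the bound on T pays for rounding the initial distance to the grid. *)
Lemma run_reaches_accuracy (eps ph0 ph1 nu t : R) (T : nat) :
  let Db := C1 * eps - C2 * epsg in
  let h := C3 * gamma ^+ 2 * Db ^+ 2 in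
  let c := ph0 + ph1 - 3 / 2 - (nu + r) / h in
  0 < Db -> (0 < T)%N -> 0 < c ->
  c^-1 * ((phi x0 - phihat + t) / h
          + 2^-1 * logb gamma (Num.min (Db / delta0)
              (delta0 / (C1 * enorm (grad phi x0) - C2 * epsg)))
          + 2^-1) <= T%:R ->
  \sum_(k < T) (~~ accurate k)%:R <= (1 - ph1) * T%:R ->
  \sum_(k < T) (~~ small_err k)%:R <= (1 - ph0) * T%:R ->
  \sum_(k < T) err k <= T%:R * nu + t ->
  exists2 k, (k < T)%N & enorm (grad phi (x k)) <= eps.
Proof.
move=> Db h c Db0 T0 c0 hT n1 n0 n2.
have h0 : 0 < h.
  have /andP[g0 g1] := hgamma.
  by rewrite /h mulr_gt0 ?exprn_gt0// mulr_gt0 ?exprn_gt0 ?const3_gt0.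
apply: contrapT => none.
have large k : (k < T)%N -> eps < enorm (grad phi (x k)).
  by move=> kT; rewrite ltNge; apply/negP => le_eps; apply: none; exists k.
have M_ge : Db <= C1 * enorm (grad phi x0) - C2 * epsg.
  by rewrite lerD2r ler_pM2l ?const1_gt0// -(run_x0 hrun) ltW// large.
have [j [jle jgt jlt]] := initial_level hgamma hdelta0 Db0 M_ge.
have bound := run_bound Db0 large jle jgt.
move: bound n1 n0 n2; rewrite -/Db -/h.
set s1 := \sum_(k < T) (~~ accurate k)%:R.
set s0 := \sum_(k < T) (~~ small_err k)%:R.
set s2 := \sum_(k < T) err k.
move=> bound n1 n0 n2.
have hs : h * (T%:R * (ph0 + ph1 - 3 / 2) - `|j|%N%:R / 2) <=
    phi x0 - phihat + t + T%:R * (nu + r).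
  apply: le_trans (_ : _ <= h * (T%:R / 2 - s1 - s0 - `|j|%N%:R / 2)) _.
    apply: ler_wpM2l; first exact: ltW.
    by move: n1 n0; lra.
  by apply: le_trans bound _; move: n2; lra.
have hs' : c * T%:R <= (phi x0 - phihat + t) / h + `|j|%N%:R / 2.
  rewrite -(ler_pM2l h0) /c.
  have -> : h * ((ph0 + ph1 - 3 / 2 - (nu + r) / h) * T%:R) =
    h * (T%:R * (ph0 + ph1 - 3 / 2)) - T%:R * (nu + r).
    by field; rewrite gt_eqF.
  have -> : h * ((phi x0 - phihat + t) / h + `|j|%:R / 2) =
    phi x0 - phihat + t + h * (`|j|%:R / 2).
    by field; rewrite gt_eqF.
  by move: hs; lra.
move: hT hs' jlt; rewrite ler_pdivrMl//; lra.
Qed.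

End run.

(** * Exponential inequalities *)

Section exponential_inequalities.
Context {R : realType}.
Implicit Types x y l q : R.

(** The tangent to [expR] at the barycentre lies below its graph. *)
Lemma expR_convex (t x y : R) : 0 <= t <= 1 ->
  expR (t * x + (1 - t) * y) <= t * expR x + (1 - t) * expR y.
Proof.
move=> /andP[t0 t1]; set m := t * x + (1 - t) * y.
have h z : expR m * (1 + (z - m)) <= expR z.
  have -> : expR z = expR m * expR (z - m) by rewrite -expRD subrKC.
  by apply: ler_wpM2l; rewrite ?expR_ge0 ?expR_ge1Dx.
have : t * (expR m * (1 + (x - m))) + (1 - t) * (expR m * (1 + (y - m))) <=
    t * expR x + (1 - t) * expR y.
  by rewrite lerD// ler_wpM2l// ?subr_ge0.
apply: le_trans; rewrite le_eqVlt; apply/orP; left; apply/eqP.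
by set e := expR m; rewrite /m; ring.
Qed.

(** The sign of the derivative that [expR_cosh_le] needs. *)
Lemma cosh_derive_sign x : 0 <= x ->
  (1 - x) * expR x <= (1 + x) * expR (- x).
Proof.
move=> x0; pose g (y : R) : R := (1 - y) * expR y - (1 + y) * expR (- y).
have dg (y : R) : is_derive y 1 g (- y * (expR y - expR (- y))).
  rewrite /g; apply: is_derive_eq.
  rewrite /GRing.scale /=; ring.
have : g x <= g 0.
  apply: (@ler0_derive1_nincry _ g 0) => //.
  - move=> y; rewrite in_itv/= andbT => y0.
    rewrite derive1E derive_val mulNr oppr_le0 mulr_ge0 ?(ltW y0)//.
    by rewrite subr_ge0 ler_expR; lra.
  - apply: continuous_subspaceT => y; apply: differentiable_continuous.
    by apply/derivable1_diffP; exact: ex_derive.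
rewrite /g !(oppr0, subr0, addr0, mul1r, subrr, expR0) subr_le0; exact.
Qed.

(** [exp (x - x^2/2) + exp (- x - x^2/2)] decreases on the nonnegative reals
    and equals 2 at 0. *)
Lemma expR_cosh_le x : 0 <= x -> expR x + expR (- x) <= 2 * expR (x ^+ 2 / 2).
Proof.
move=> x0.
pose g (y : R) : R := expR (y - y ^+ 2 / 2) + expR (- y - y ^+ 2 / 2).
have dg (y : R) : is_derive y 1 g
    (expR (- (y ^+ 2 / 2)) * ((1 - y) * expR y - (1 + y) * expR (- y))).
  rewrite /g; apply: is_derive_eq.
  rewrite /GRing.scale /= !expRD; by field.
have : g x <= g 0.
  apply: (@ler0_derive1_nincry _ g 0) => //.
  - move=> y; rewrite in_itv/= andbT => y0.
    rewrite derive1E derive_val mulr_ge0_le0 ?expR_ge0// subr_le0.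
    exact/cosh_derive_sign/ltW.
  - apply: continuous_subspaceT => y; apply: differentiable_continuous.
    by apply/derivable1_diffP; exact: ex_derive.
rewrite /g expr0n/= mul0r !(subr0, oppr0, expR0) !expRD -mulrDl.
by rewrite (expRN (x ^+ 2 / 2)) ler_pdivrMr ?expR_gt0.
Qed.

(** Moment generating function of a centred Bernoulli variable with parameter
    [q <= 1/2].  It takes its values in [[- p, p]] with [p = 1 - q], so
    convexity compares it with the symmetric variable on [{- p, p}], whose
    generating function is [cosh (l p)]. *)
Lemma bernoulli_mgf_le q l : 0 <= q <= 2^-1 -> 0 <= l ->
  (1 - q) * expR (- (l * q)) + q * expR (l * (1 - q)) <=
  expR (l ^+ 2 * (1 - q) ^+ 2 / 2).
Proof.
move=> /andP[q0 q2] l0; set p := 1 - q.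
have p2 : 2^-1 <= p by rewrite /p; lra.
have p0 : 0 < p by lra.
have pn0 : p != 0 by rewrite gt_eqF.
have qE : q = 1 - p by rewrite /p; ring.
(* - q is the barycentre of p and - p with weights th and 1 - th *)
pose th := (2 * p - 1) / (2 * p).
have h : expR (- (l * q)) <= th * expR (l * p) + (1 - th) * expR (- (l * p)).
  have -> : - (l * q) = th * (l * p) + (1 - th) * (- (l * p)).
    by rewrite {1}qE /th; field.
  apply: expR_convex; rewrite /th; apply/andP; split.
    by rewrite divr_ge0; lra.
  by rewrite ler_pdivrMr; lra.
have lp0 : 0 <= l * p by rewrite mulr_ge0// ltW.
have := expR_cosh_le lp0.
rewrite exprMn => hc.
have hp : p * expR (- (l * q)) <=
    p * (th * expR (l * p) + (1 - th) * expR (- (l * p))).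
  by apply: ler_wpM2l => //; exact: ltW.
have e : p * (th * expR (l * p) + (1 - th) * expR (- (l * p))) +
    q * expR (l * p) = (expR (l * p) + expR (- (l * p))) / 2.
  by rewrite {1}qE /th; field.
lra.
Qed.
End exponential_inequalities.

(** * Integrating conditional probability bounds *)

Section conditional_domination.
Context d {Omega : measurableType d} {R : realType}.
Variable P : {measure set Omega -> \bar R}.
Variable G : set (set Omega).
Hypothesis mG : <<s G >> `<=` measurable.

Local Notation GT := (g_sigma_algebraType G).

Let idG (w : Omega) : GT := w.

Let midG : measurable_fun [set: Omega] idG.
Proof. by move=> _ A mA; rewrite setTI; exact: mG. Qed.

Lemma measurable_fun_subalgebra d' (U : sigmaRingType d') (W : GT -> U) :
  measurable_fun setT W -> measurable_fun setT (W : Omega -> U).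
Proof.
move=> mW _ A mA; rewrite setTI; apply: mG.
by rewrite -[X in <<s _ >> X]setTI; exact: mW.
Qed.

(** A bound [P (B | G) <= q], tested on the sets of the sigma-algebra generated
    by G, holds for every nonnegative weight W measurable for that
    sigma-algebra: seen on the smaller sigma-algebra, the trace of P on B is a
    measure dominated by [q P]. *)
Lemma integral_cond_le (B : set Omega) (q : R) (W : Omega -> \bar R) :
  measurable B -> 0 <= q ->
  (forall A, <<s G >> A -> (P (B `&` A) <= q%:E * P A)%E) ->
  (forall w, 0 <= W w)%E ->
  measurable_fun [set: GT] (W : GT -> \bar R) ->
  (\int[P]_(w in B) W w <= q%:E * \int[P]_w W w)%E.
Proof.
move=> mB q0 hB W0 mW.
have mW' : measurable_fun [set: Omega] W by exact: measurable_fun_subalgebra.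
have -> : (\int[P]_(w in B) W w = \int[mrestr P mB]_(w in B) W w)%E.
  apply: eq_measure_integral => A mA AB.
  by rewrite /= /mrestr setIidl.
apply: (@le_trans _ _ (\int[mrestr P mB]_w W w)%E).
  by apply: ge0_subset_integral => //.
(* the restriction of a measure to the smaller sigma-algebra *)
pose push (m : {measure set Omega -> \bar R}) : {measure set GT -> \bar R} :=
  pushforward m idG.
have pushE (m : {measure set Omega -> \bar R}) :
    (\int[m]_w W w = \int[push midG m]_(w in [set: GT]) W w)%E.
  by symmetry; apply: (ge0_integral_pushforward midG m) => // y _.
rewrite !pushE.
pose m3 : {measure set GT -> \bar R} := mscale (NngNum q0) (push midG P).
have -> : (q%:E * \int[push midG P]_(w in [set: GT]) W w =
    \int[m3]_(w in [set: GT]) W w)%E.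
  by symmetry; apply: ge0_integral_mscale => // w _.
apply: ge0_le_measure_integral => // A mA.
by rewrite /= /mscale /pushforward /mrestr /= setIC; exact: hB.
Qed.
End conditional_domination.

Section conditional_probability_bounds.
Context d {Omega : measurableType d} {R : realType}.
Variable P : probability Omega R.
Variable G : set (set Omega).
Hypothesis mG : <<s G >> `<=` measurable.

Lemma cond_prob_le_measure (A B : set Omega) (c : R) : 0 <= c ->
  cond_prob_le P G A c -> <<s G >> B -> (P (A `&` B) <= c%:E * P B)%E.
Proof.
move=> c0 [Z [mZ iZ hZ] Zc] GB; rewrite -hZ//.
have mB := mG GB.
have mZ' : measurable_fun [set: Omega] (EFin \o Z).
  exact/measurable_EFinP/(measurable_fun_subalgebra mG mZ).
have mZB : measurable_fun B (EFin \o Z) by exact: measurable_funS mZ'.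
apply: (@le_trans _ _ (\int[P]_(w in B) ((EFin \o Z)^\+ w))%E).
  rewrite [leLHS]integralE geeDl// oppe_le0; apply: integral_ge0 => w _.
  exact: funeneg_ge0.
rewrite -integral_cst//; apply: ae_ge0_le_integral => //.
- exact: measurable_funepos.
- apply: filterS Zc => w Zw _.
  by rewrite funeposE ge_max lee_fin Zw lee_fin.
Qed.

(** A lower bound on P (A | G), turned into the kind of upper bound that
    [integral_cond_le] takes. *)
Lemma cond_prob_ge_measureC (A B : set Omega) (c : R) : 0 <= c ->
  measurable A -> cond_prob_ge P G A c -> <<s G >> B ->
  (P (~` A `&` B) <= (1 - c)%:E * P B)%E.
Proof.
move=> c0 mA [Z [mZ iZ hZ] Zc] GB.
have mB := mG GB.
have mZ' : measurable_fun [set: Omega] (EFin \o Z).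
  exact/measurable_EFinP/(measurable_fun_subalgebra mG mZ).
have mZB : measurable_fun B (EFin \o Z) by exact: measurable_funS mZ'.
have cP : (c%:E * P B <= P (A `&` B))%E.
  rewrite -hZ// integralE.
  have -> : (\int[P]_(w in B) ((EFin \o Z)^\- w) = 0)%E.
    apply/eqP; rewrite eq_le integral_ge0 ?andbT//; last first.
    apply: (@le_trans _ _ (\int[P]_(w in B) (cst 0 w))%E); last first.
      by rewrite integral0.
    apply: ae_ge0_le_integral => //; first exact: measurable_funeneg.
    apply: filterS Zc => w Zw _.
    by rewrite funenegE ge_max lexx andbT leeNl oppe0 lee_fin (le_trans c0).
  rewrite sube0 -integral_cst//; apply: ae_ge0_le_integral => //.
  - exact: measurable_funepos.
  - by apply: filterS Zc => w Zw _; rewrite funeposE le_max lee_fin Zw.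
have PB : P B = (P (A `&` B) + P (~` A `&` B))%E.
  rewrite -[in LHS](setIT B) -(setUv A) setIUr measureU//.
  - by rewrite ![B `&` _]setIC.
  - exact: measurableI.
  - by apply: measurableI => //; exact: measurableC.
  - by rewrite setIACA setICr setI0.
move: cP PB; rewrite -(fineK (fin_num_measure P B _))//.
rewrite -(fineK (fin_num_measure P (A `&` B) _)); last exact: measurableI.
rewrite -(fineK (fin_num_measure P (~` A `&` B) _)); last first.
  by apply: measurableI => //; exact: measurableC.
rewrite -!EFinM -EFinD !lee_fin => h [e]; lra.
Qed.
End conditional_probability_bounds.

Lemma integral_mul_indic d {Omega : measurableType d} {R : realType}
  (P : {measure set Omega -> \bar R}) (A : set Omega) (W : Omega -> \bar R) :
  (\int[P]_w (W w * (\1_A w)%:E) = \int[P]_(w in A) W w)%E.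
Proof.
rewrite [RHS]integral_mkcond; apply: eq_integral => w _.
by rewrite patchE indicE; case: (_ \in _); rewrite ?mule1 ?mule0.
Qed.

(** * Concentration of the number of bad iterations *)

Section exponential_markov.
Context d {Omega : measurableType d} {R : realType}.
Variable P : probability Omega R.

Lemma exp_markov (Y : Omega -> R) (c l : R) : measurable_fun setT Y -> 0 <= l ->
  (P [set w | (c < Y w)%R] <=
   (expR (- (l * c)))%:E * \int[P]_w (expR (l * Y w))%:E)%E.
Proof.
move=> mY l0; set A := [set w | _].
have mA : measurable A.
  rewrite (_ : A = Y @^-1` `]c, +oo[); last first.
    by apply/seteqP; split => w /=; rewrite in_itv/= andbT.
  by rewrite -[X in measurable X]setTI; exact: mY.
have mE : measurable_fun setT (fun w => (expR (l * Y w))%:E).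
  apply/measurable_EFinP; apply: measurableT_comp => //.
  exact: measurable_funM.
have E0 w : (0 <= (expR (l * Y w))%:E)%E by rewrite lee_fin expR_ge0.
rewrite -ge0_integralZl// ?lee_fin ?expR_ge0//.
rewrite -[A in leLHS]setIT -integral_indic//; apply: ge0_le_integral => //=.
- by apply/measurable_EFinP; exact: measurable_indic.
- apply: measurable_funeM => //.
- move=> w _; rewrite -EFinM lee_fin -expRD indicE.
  have [/set_mem wA|_] := boolP (w \in A); last by rewrite expR_ge0.
  rewrite -[leLHS]expR0 ler_expR addrC subr_ge0.
  by apply: ler_wpM2l => //; exact: ltW.
Qed.
End exponential_markov.

Section dominated_events.
Context d {Omega : measurableType d} {R : realType}.
Variable P : probability Omega R.
Variable G : nat -> set (set Omega).
Hypothesis mG : forall k, <<s G k >> `<=` measurable.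
Hypothesis G_incr : forall k, <<s G k >> `<=` <<s G k.+1 >>.

Lemma measurable_wrt_sub (G1 G2 : set (set Omega)) (Y : Omega -> R) :
  <<s G1 >> `<=` <<s G2 >> -> measurable_wrt G1 Y -> measurable_wrt G2 Y.
Proof.
move=> s mY _ A mA; rewrite setTI; apply: s.
by rewrite -[X in <<s _ >> X]setTI; exact: mY.
Qed.

Variables (B : nat -> set Omega) (q : R).
Hypothesis q01 : 0 <= q <= 1.
Hypothesis GB : forall k, <<s G k.+1 >> (B k).
Hypothesis PB : forall k A, <<s G k >> A -> (P (B k `&` A) <= q%:E * P A)%E.

Let N T w : R := \sum_(k < T) \1_(B k) w.

Lemma measurable_count T : measurable_wrt (G T) (N T).
Proof.
elim: T => [|T IH].
  by rewrite /N; under eq_fun do rewrite big_ord0; exact: measurable_cst.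
rewrite /N; under eq_fun do rewrite big_ord_recr /=.
apply: measurable_funD; first exact: (measurable_wrt_sub (@G_incr T)).
exact: (@measurable_indic _ (g_sigma_algebraType (G T.+1)) R setT (B T) (@GB T)).
Qed.

(** As an inequality of moments, the count behaves like a binomial variable:
    the exponential of the count over the first T events is a weight known at
    time T, to which [integral_cond_le] applies. *)
Lemma count_mgf_le T l : 0 <= l ->
  (\int[P]_w (expR (l * N T w))%:E <= ((1 - q + q * expR l) ^+ T)%:E)%E.
Proof.
move: q01 => /andP[q0 q1] l0; elim: T => [|T IH].
  rewrite (_ : (fun w => _) = cst 1%E); last first.
    by apply/funext => w; rewrite /N big_ord0 mulr0 expR0.
  by rewrite integral_cst//= probability_setT mule1 expr0.
pose W w := (expR (l * N T w))%:E.
have W0 w : (0 <= W w)%E by rewrite lee_fin expR_ge0.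
have mWG : measurable_fun [set: g_sigma_algebraType (G T)]
    (W : g_sigma_algebraType (G T) -> \bar R).
  apply/measurable_EFinP; apply: measurableT_comp => //.
  apply: measurable_funM => //; exact: measurable_count.
have mW : measurable_fun setT W by exact: (measurable_fun_subalgebra (@mG T)).
have mB : measurable (B T) by exact: (mG (@GB T)).
have eNS w : (expR (l * N T.+1 w))%:E =
    (W w + (expR l - 1)%:E * (W w * (\1_(B T) w)%:E))%E.
  rewrite /W /N big_ord_recr /= mulrDr expRD -!EFinM -EFinD; congr EFin.
  rewrite indicE; case: (_ \in _); rewrite /= ?mulr0 ?mulr1 ?expR0; ring.
have el0 : 0 <= expR l - 1 by rewrite subr_ge0 -expR0 ler_expR.
under eq_integral do rewrite eNS.
have m1 : measurable_fun setT (fun w => (\1_(B T) w)%:E : \bar R).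
  by apply/measurable_EFinP; exact: measurable_indic.
have m2 : measurable_fun setT (fun w => W w * (\1_(B T) w)%:E)%E.
  exact: emeasurable_funM.
have p2 w : (0 <= W w * (\1_(B T) w)%:E)%E by rewrite mule_ge0 ?lee_fin.
rewrite ge0_integralD//; last 2 first.
- by move=> w _; rewrite mule_ge0 ?lee_fin.
- exact: measurable_funeM.
rewrite ge0_integralZl ?lee_fin//.
rewrite integral_mul_indic.
apply: (@le_trans _ _ (\int[P]_w W w +
    (expR l - 1)%:E * (q%:E * \int[P]_w W w))%E).
  apply: leeD => //; apply: lee_wpmul2l; rewrite ?lee_fin//.
  by apply: (integral_cond_le (@mG T)) => // A; exact: PB.
have If : (\int[P]_w W w)%E \is a fin_num.
  by rewrite ge0_fin_numE ?integral_ge0// (le_lt_trans IH) ?ltry.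
have {}IH : fine (\int[P]_w W w) <= (1 - q + q * expR l) ^+ T.
  by rewrite -lee_fin fineK.
rewrite -(fineK If) -!EFinM -EFinD lee_fin exprS.
set I := fine _ in IH *.
have -> : I + (expR l - 1) * (q * I) = (1 - q + q * expR l) * I by ring.
apply: ler_wpM2l => //; rewrite addr_ge0// ?subr_ge0// mulr_ge0// expR_ge0.
Qed.

End dominated_events.

(** Azuma-Hoeffding bound for events of conditional probability at most
    [1 - p].  For [p >= 1/2] an increment centred at its conditional mean is
    at most p in absolute value, which gives the exponent
    [(p - ph)^2 / (2 p^2) = (1 - ph / p)^2 / 2] per event. *)
Lemma count_tail d {Omega : measurableType d} {R : realType}
  (P : probability Omega R) (G : nat -> set (set Omega)) 
  (B : nat -> set Omega) (p ph : R) (T : nat) :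
  (forall k, <<s G k >> `<=` measurable) ->
  (forall k, <<s G k >> `<=` <<s G k.+1 >>) ->
  2^-1 <= p <= 1 -> ph <= p ->
  (forall k, <<s G k.+1 >> (B k)) ->
  (forall k A, <<s G k >> A -> (P (B k `&` A) <= (1 - p)%:E * P A)%E) ->
  (P [set w | ((1 - ph) * T%:R < \sum_(k < T) \1_(B k) w)%R] <=
   (expR (- ((1 - ph / p) ^+ 2 / 2 * T%:R)))%:E)%E.
Proof.
move=> mG Gi /andP[p2 p1] php GB PB.
have p0 : 0 < p by lra.
(* l minimises l^2 p^2 / 2 - l (p - ph) *)
pose l := (p - ph) / p ^+ 2.
have l0 : 0 <= l by rewrite divr_ge0 ?subr_ge0 ?sqr_ge0.
have q01 : 0 <= 1 - p <= 1 by lra.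
have mN : measurable_fun setT (fun w => \sum_(k < T) \1_(B k) w : R).
  have := @measurable_count _ Omega R G Gi B GB T.
  exact: measurable_fun_subalgebra.
apply: (le_trans (exp_markov P _ mN l0)).
apply: (@le_trans _ _ ((expR (- (l * ((1 - ph) * T%:R))))%:E *
    ((1 - (1 - p) + (1 - p) * expR l) ^+ T)%:E)%E).
  apply: lee_wpmul2l; first by rewrite lee_fin expR_ge0.
  exact: (count_mgf_le mG Gi q01 GB PB).
have h : 1 - (1 - p) + (1 - p) * expR l <=
    expR (l * (1 - p) + l ^+ 2 * p ^+ 2 / 2).
  have q02 : 0 <= 1 - p <= 2^-1 by lra.
  have := bernoulli_mgf_le q02 l0; rewrite subKr expRD.
  set u := l * (1 - p) => hb.
  rewrite -ler_pdivrMl ?expR_gt0// -expRN; apply: le_trans hb.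
  rewrite mulrDr le_eqVlt; apply/orP; left; apply/eqP.
  have -> : l * p = - u + l by rewrite /u; ring.
  by rewrite expRD; ring.
rewrite -EFinM lee_fin.
apply: (@le_trans _ _ (expR (- (l * ((1 - ph) * T%:R))) *
    expR (l * (1 - p) + l ^+ 2 * p ^+ 2 / 2) ^+ T)).
  apply: ler_wpM2l; first exact: expR_ge0.
  apply: lerXn2r => //; rewrite ?nnegrE ?expR_ge0//.
  by rewrite addr_ge0 ?subKr ?mulr_ge0 ?expR_ge0//; lra.
rewrite -expRM_natr -expRD ler_expR le_eqVlt; apply/orP; left; apply/eqP.
by rewrite /l; field; rewrite gt_eqF.
Qed.

(** * Concentration of subexponential errors *)

Section subexponential_mgf.
Context d {Omega : measurableType d} {R : realType}.
Variable P : probability Omega R.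

Lemma measurable_gt_set (E : Omega -> R) (t : R) :
  measurable_fun setT E -> measurable [set w | t < E w].
Proof.
move=> mE; rewrite (_ : [set w | _] = E @^-1` `]t, +oo[); last first.
  by apply/seteqP; split => w /=; rewrite in_itv/= andbT.
by rewrite -[X in measurable X]setTI; exact: mE.
Qed.

(** Discrete layer-cake bound: climbing from level t i to level t i.+1
    multiplies the exponential by y, and each climb is charged to the event
    that E exceeds the level t i. *)
Lemma expR_le_layers (y a : R) (E : R) (t : nat -> R) :
  1 < y -> (forall n, expR (a * t n) = y ^+ n) -> 0 < a ->
  forall n, Num.min (expR (a * E)) (y ^+ n) <=
    1 + \sum_(0 <= i < n) y ^+ i * (y - 1) * (t i < E)%R%:R.
Proof.
move=> y1 ty a0; elim=> [|n IH].
  by rewrite big_nil addr0 expr0 ge_min lexx orbT.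
rewrite big_nat_recr//= addrA.
have [tE|Et] := ltrP (t n) E.
  rewrite mulr1; apply: (@le_trans _ _ (Num.min (expR (a * E)) (y ^+ n) +
      y ^+ n * (y - 1))); last by rewrite lerD2r.
  have yn0 : 0 <= y ^+ n * (y - 1) by rewrite mulr_ge0 ?exprn_ge0//; lra.
  rewrite /Num.min; case: ifPn => h1; case: ifPn => h2.
  - by rewrite lerDl.
  - by move: h2; rewrite -leNgt => h2; rewrite (le_trans (ltW h1))// exprS; lra.
  - by rewrite -leNgt in h1; rewrite (le_trans h1)// lerDl.
  - by rewrite exprS; lra.
rewrite mulr0 addr0; apply: le_trans IH; rewrite ge_min; apply/orP; left.
rewrite le_min lexx /= -ty ler_expR.
by apply: ler_wpM2l => //; exact: ltW.
Qed.

Variable G : set (set Omega).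
Hypothesis mG : <<s G >> `<=` measurable.

(** With levels spaced so that [exp (a E / 2)] grows by the factor y from one
    to the next, the tail bound decays by y^2 per level; the resulting
    geometric series has sum [1 + y], and [y = 5/4] keeps it below e.  The
    exact integration of the tail would give 2 in place of [1 + y]. *)
Lemma subexp_mgf_le (E : Omega -> R) (a epsf : R) (W : Omega -> \bar R) :
  0 < a -> 0 <= epsf -> measurable_fun setT E ->
  (forall t A, 0 <= t -> <<s G >> A ->
    (P ([set w | (t < E w)%R] `&` A) <= (expR (a * (epsf - t)))%:E * P A)%E) ->
  (forall w, 0 <= W w)%E ->
  measurable_fun [set: g_sigma_algebraType G]
    (W : g_sigma_algebraType G -> \bar R) ->
  (\int[P]_w (W w * (expR (a / 2 * E w))%:E) <=
   (expR (1 + a * epsf / 2))%:E * \int[P]_w W w)%E.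
Proof.
move=> a0 epsf0 mE tailE W0 mWG.
have mW : measurable_fun setT W by exact: (measurable_fun_subalgebra mG).
pose y : R := 5 / 4.
have y1 : 1 < y by rewrite /y; lra.
pose tau := 2 * ln y / a.
have tau0 : 0 <= tau by rewrite divr_ge0 ?ltW// mulr_gt0// ln_gt0.
pose t (n : nat) : R := epsf + n%:R * tau.
have t0 n : 0 <= t n by rewrite addr_ge0// mulr_ge0.
have ty n : expR (a / 2 * (t n - epsf)) = y ^+ n.
  rewrite /t /tau -[y in RHS]lnK ?posrE; last by lra.
  rewrite -expRM_natl; congr expR; field; lra.
pose c n : R := y ^+ n * (y - 1).
have c0 n : 0 <= c n by rewrite mulr_ge0 ?exprn_ge0//; lra.
pose A n := [set w | t n < E w].
have mA n : measurable (A n) by exact: measurable_gt_set.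
pose f n w : \bar R := ((c n)%:E * (W w * (\1_(A n) w)%:E))%E.
have f0 n w : (0 <= f n w)%E by rewrite !mule_ge0 ?lee_fin.
have mWA n : measurable_fun setT (fun w => W w * (\1_(A n) w)%:E)%E.
  apply: emeasurable_funM => //.
  by apply/measurable_EFinP; exact: measurable_indic.
have mf n : measurable_fun setT (f n) by exact: measurable_funeM.
have pw w : (W w * (expR (a / 2 * (E w - epsf)))%:E <=
    W w + \sum_(n <oo) f n w)%E.
  have [n hn] : exists n, expR (a / 2 * (E w - epsf)) <= y ^+ n.
    pose x := (a / 2 * (E w - epsf)) / ln y.
    exists (Num.truncn x).+1.
    rewrite -[y]lnK ?posrE; last by lra.
    rewrite -expRM_natl ler_expR -ler_pdivrMr ?ln_gt0//.
    exact/ltW/truncnS_gt.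
  have := @expR_le_layers y (a / 2) (E w - epsf) (fun n => t n - epsf) y1 ty.
  rewrite divr_gt0// => /(_ isT n); rewrite min_l//.
  under eq_bigr do rewrite ltrD2r -/(c _).
  move=> h.
  apply: (@le_trans _ _
      (W w * (1 + \sum_(0 <= i < n) c i * (t i < E w)%R%:R)%:E)%E).
    by apply: lee_wpmul2l; rewrite ?lee_fin.
  have cs0 : 0 <= \sum_(0 <= i < n) c i * (t i < E w)%R%:R.
    by apply: sumr_ge0 => i _; rewrite mulr_ge0.
  rewrite EFinD ge0_muleDr ?lee_fin// mule1.
  apply: leeD => //.
  apply: (@le_trans _ _ (\sum_(0 <= i < n) f i w)%E); last first.
    exact: nneseries_lim_ge.
  rewrite -sumEFin ge0_sume_distrr; last first.
    by move=> i _; rewrite lee_fin mulr_ge0.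
  apply: lee_sum => i _; rewrite /f indicE mem_setE/= EFinM muleCA.
  by [].
have iA n : (\int[P]_w f n w <= ((y - 1) * y ^- n)%:E * \int[P]_w W w)%E.
  rewrite ge0_integralZl ?lee_fin//; last first.
    by move=> w _; rewrite mule_ge0 ?lee_fin.
  rewrite integral_mul_indic.
  have := @integral_cond_le _ _ _ P _ mG (A n) (expR (a * (epsf - t n))) W
    (mA n) (expR_ge0 _) (fun B => tailE (t n) B (t0 n)) W0 mWG.
  have -> : a * (epsf - t n) = - (2%:R * (a / 2 * (t n - epsf))) by field.
  rewrite expRN expRM_natl ty => h.
  apply: le_trans (lee_wpmul2l _ h) _; rewrite ?lee_fin// muleA -EFinM.
  rewrite /c (_ : y ^+ n * (y - 1) * _ = (y - 1) * y ^- n)//.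
  by field; rewrite expf_neq0// gt_eqF//; lra.
have geom n : \sum_(0 <= i < n) (y - 1) * y ^- i = y - y ^- n * y.
  elim: n => [|n IH]; first by rewrite big_nil expr0 invr1 mul1r subrr.
  rewrite big_nat_recr//= IH exprS; field.
  by rewrite expf_neq0 ?gt_eqF//; lra.
have S : (\sum_(n <oo) \int[P]_w f n w <= y%:E * \int[P]_w W w)%E.
  apply: lime_le.
    by apply: is_cvg_nneseries => n _ _; exact: integral_ge0.
  apply: nearW => n.
  apply: (@le_trans _ _
      (\sum_(0 <= i < n) (((y - 1) * y ^- i)%:E * \int[P]_w W w))%E).
    by apply: lee_sum => i _; exact: iA.
  rewrite -ge0_sume_distrl; last first.
    by move=> i _; rewrite lee_fin mulr_ge0 ?invr_ge0 ?exprn_ge0//; lra.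
  rewrite sumEFin geom; apply: lee_wpmul2r; first exact: integral_ge0.
  by rewrite lee_fin lerBlDr lerDl mulr_ge0 ?invr_ge0 ?exprn_ge0//; lra.
(* e = exp (1/2) ^ 2 >= (3/2)^2 = 1 + y *)
have e1 : 1 + y <= expR 1.
  have -> : (1 : R) = 2%:R * 2^-1 :> R by lra.
  rewrite expRM_natl; have := expR_ge1Dx (2^-1 : R).
  by move=> h; rewrite expr2 (le_trans _ (ler_pM _ _ h h))//; rewrite /y; lra.
have main : (\int[P]_w (W w * (expR (a / 2 * (E w - epsf)))%:E) <=
    (expR 1)%:E * \int[P]_w W w)%E.
  apply: (@le_trans _ _ (\int[P]_w (W w + \sum_(n <oo) f n w))%E).
    apply: ge0_le_integral => //.
    - by move=> w _; rewrite mule_ge0 ?lee_fin ?expR_ge0.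
    - apply: emeasurable_funM => //; apply/measurable_EFinP.
      apply: measurableT_comp => //; apply: measurable_funM => //.
      exact: measurable_funB.
    - by apply: emeasurable_funD => //; exact: ge0_emeasurable_sum.
  rewrite ge0_integralD//; last 2 first.
  - by move=> w _; rewrite nneseries_ge0.
  - exact: ge0_emeasurable_sum.
  rewrite integral_nneseries//.
  apply: (@le_trans _ _ (\int[P]_w W w + y%:E * \int[P]_w W w)%E).
    exact: leeD.
  rewrite -[X in (X + _)%E]mul1e -ge0_muleDl ?lee_fin//; last by lra.
  by apply: lee_wpmul2r; rewrite ?lee_fin ?integral_ge0.
have -> : (\int[P]_w (W w * (expR (a / 2 * E w))%:E) =
    (expR (a * epsf / 2))%:E *
    \int[P]_w (W w * (expR (a / 2 * (E w - epsf)))%:E))%E.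
  rewrite -ge0_integralZl ?lee_fin ?expR_ge0//.
  - apply: eq_integral => w _; rewrite muleCA -EFinM -expRD.
    by congr (_ * (expR _)%:E)%E; field.
  - apply: emeasurable_funM => //; apply/measurable_EFinP.
    apply: measurableT_comp => //; apply: measurable_funM => //.
    exact: measurable_funB.
  - by move=> w _; rewrite mule_ge0 ?lee_fin ?expR_ge0.
rewrite addrC expRD EFinM -muleA.
by apply: lee_wpmul2l; rewrite ?lee_fin ?expR_ge0.
Qed.
(** Both errors are compared with [r / 2]. *)
Lemma error_pair_le (E E' : Omega -> R) (a epsf r : R) : 0 <= r ->
  measurable_fun setT E -> measurable_fun setT E' ->
  (forall t A, 0 <= t -> <<s G >> A ->
    (P ([set w | (t < E w)%R] `&` A) <= (expR (a * (epsf - t)))%:E * P A)%E) ->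
  (forall t A, 0 <= t -> <<s G >> A ->
    (P ([set w | (t < E' w)%R] `&` A) <= (expR (a * (epsf - t)))%:E * P A)%E) ->
  forall A, <<s G >> A ->
  (P ([set w | (r < E w + E' w)%R] `&` A) <=
   (2 * expR (a * (epsf - r / 2)))%:E * P A)%E.
Proof.
move=> r0 mE mE' tailE tailE' A GA; have mA := mG GA.
have r2 : 0 <= r / 2 by rewrite divr_ge0.
have m1 : measurable [set w | r / 2 < E w] by exact: measurable_gt_set.
have m2 : measurable [set w | r / 2 < E' w] by exact: measurable_gt_set.
apply: (@le_trans _ _ (P ([set w | (r / 2 < E w)%R] `&` A `|`
    [set w | (r / 2 < E' w)%R] `&` A))%E).
  rewrite le_measure ?inE//.
  - apply: measurableI => //; apply: measurable_gt_set.
    exact: measurable_funD.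
  - by apply: measurableU; exact: measurableI.
  - move=> w [/= hw Aw].
    have [h1|h1] := ltrP (r / 2) (E w); first by left.
    by right; split => //=; lra.
apply: le_trans (measureU2 _ _ _) _; try exact: measurableI.
apply: le_trans (leeD (tailE _ _ r2 GA) (tailE' _ _ r2 GA)) _.
rewrite -ge0_muleDl ?lee_fin ?expR_ge0// -EFinD.
apply: lee_wpmul2r; first exact: measure_ge0.
by rewrite lee_fin mulr_natl mulr2n.
Qed.

End subexponential_mgf.

Section error_sum.
Context d {Omega : measurableType d} {R : realType}.
Variable P : probability Omega R.
Variables G G' : nat -> set (set Omega).
Hypothesis mG : forall k, <<s G k >> `<=` measurable.
Hypothesis mG' : forall k, <<s G' k >> `<=` measurable.
Hypothesis GG' : forall k, <<s G k >> `<=` <<s G' k >>.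
Hypothesis G'G : forall k, <<s G' k >> `<=` <<s G k.+1 >>.
Variables (E E' : nat -> Omega -> R) (a epsf : R).
Hypotheses (a0 : 0 < a) (epsf0 : 0 <= epsf).
Hypothesis mE : forall k, measurable_wrt (G k.+1) (E k).
Hypothesis mE' : forall k, measurable_wrt (G k.+1) (E' k).
Hypothesis tailE : forall k t A, 0 <= t -> <<s G' k >> A ->
  (P ([set w | (t < E k w)%R] `&` A) <= (expR (a * (epsf - t)))%:E * P A)%E.
Hypothesis tailE' : forall k t A, 0 <= t -> <<s G' k >> A ->
  (P ([set w | (t < E' k w)%R] `&` A) <= (expR (a * (epsf - t)))%:E * P A)%E.

Let S T w : R := \sum_(k < T) (E k w + E' k w).

Lemma measurable_error_sum T : measurable_wrt (G T) (S T).
Proof.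
elim: T => [|T IH].
  by rewrite /S; under eq_fun do rewrite big_ord0; exact: measurable_cst.
rewrite /S; under eq_fun do rewrite big_ord_recr /=.
apply: measurable_funD; last by apply: measurable_funD; [exact: mE|exact: mE'].
by apply: measurable_wrt_sub IH => A /GG'; exact: G'G.
Qed.

(** The two errors of one iteration may depend on each other; the convexity
    bound [exp (a (E + E') / 4) <= (exp (a E / 2) + exp (a E' / 2)) / 2] lets
    [subexp_mgf_le] treat them one at a time. *)
Lemma error_mgf_le T :
  (\int[P]_w (expR (a / 4 * S T w))%:E <=
   (expR (T%:R * (1 + a * epsf / 2)))%:E)%E.
Proof.
elim: T => [|T IH].
  rewrite (_ : (fun w => _) = cst 1%E); last first.
    by apply/funext => w; rewrite /S big_ord0 mulr0 expR0.
  by rewrite integral_cst//= probability_setT mule1 mul0r expR0.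
pose W w := (expR (a / 4 * S T w))%:E.
have W0 w : (0 <= W w)%E by rewrite lee_fin expR_ge0.
have mWG : measurable_fun [set: g_sigma_algebraType (G' T)]
    (W : g_sigma_algebraType (G' T) -> \bar R).
  apply/measurable_EFinP; apply: measurableT_comp => //.
  apply: measurable_funM => //.
  by apply: (measurable_wrt_sub (@GG' T)); exact: measurable_error_sum.
have mW : measurable_fun setT W by exact: (measurable_fun_subalgebra (@mG' T)).
have mEk : measurable_fun setT (E T).
  by apply: (measurable_fun_subalgebra (@mG T.+1)); exact: mE.
have mEk' : measurable_fun setT (E' T).
  by apply: (measurable_fun_subalgebra (@mG T.+1)); exact: mE'.
have mgf :=
  subexp_mgf_le (@mG' T) a0 epsf0 mEk (fun t A t0 => tailE t0) W0 mWG.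
have mgf' :=
  subexp_mgf_le (@mG' T) a0 epsf0 mEk' (fun t A t0 => tailE' t0) W0 mWG.
have mX (X : Omega -> R) : measurable_fun setT X ->
    measurable_fun setT (fun w => W w * (expR (a / 2 * X w))%:E)%E.
  move=> mX; apply: emeasurable_funM => //; apply/measurable_EFinP.
  by apply: measurableT_comp => //; exact: measurable_funM.
have X0 (X : Omega -> R) w : (0 <= W w * (expR (a / 2 * X w))%:E)%E.
  by rewrite mule_ge0 ?lee_fin ?expR_ge0.
apply: (@le_trans _ _ (\int[P]_w (2^-1%:E *
    (W w * (expR (a / 2 * E T w))%:E + W w * (expR (a / 2 * E' T w))%:E)))%E).
  apply: ge0_le_integral => //.
  - apply/measurable_EFinP; apply: measurableT_comp => //.
    apply: measurable_funM => //.
    by apply: (measurable_fun_subalgebra (@mG T.+1)); exact: measurable_error_sum.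
  - by apply: measurable_funeM; apply: emeasurable_funD; exact: mX.
  - move=> w _; rewrite /W -!EFinM lee_fin -mulrDr mulrCA.
    rewrite /S big_ord_recr /= mulrDr expRD.
    apply: ler_wpM2l; first exact: expR_ge0.
    have h : 0 <= (2^-1 : R) <= 1 by lra.
    have := expR_convex (a / 2 * E T w) (a / 2 * E' T w) h.
    have -> : 2^-1 * (a / 2 * E T w) + (1 - 2^-1) * (a / 2 * E' T w) =
      a / 4 * (E T w + E' T w) by field.
    move=> /le_trans; apply; lra.
have D0 w : (0 <= W w * (expR (a / 2 * E T w))%:E +
    W w * (expR (a / 2 * E' T w))%:E)%E by rewrite adde_ge0.
rewrite ge0_integralZl ?lee_fin//; last first.
  by apply: emeasurable_funD; exact: mX.
rewrite ge0_integralD//; try exact: mX.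
apply: (@le_trans _ _ (2^-1%:E * ((expR (1 + a * epsf / 2))%:E *
    (expR (T%:R * (1 + a * epsf / 2)))%:E + (expR (1 + a * epsf / 2))%:E *
    (expR (T%:R * (1 + a * epsf / 2)))%:E))%E).
  apply: lee_wpmul2l; rewrite ?lee_fin//.
  by apply: leeD; [apply: le_trans mgf _|apply: le_trans mgf' _];
    apply: lee_wpmul2l; rewrite ?lee_fin ?expR_ge0.
rewrite -!EFinM lee_fin -(natr1 T) mulrDl mul1r (addrC (T%:R * _)).
rewrite [in leRHS]expRD; lra.
Qed.

Lemma error_sum_tail (T : nat) (t : R) :
  (P [set w | (T%:R * (2 * epsf + 4 / a) + t < \sum_(k < T) (E k w + E' k w))%R]
   <= (expR (- (a / 4 * t)))%:E)%E.
Proof.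
have mS : measurable_fun setT (S T).
  by apply: (measurable_fun_subalgebra (@mG T)); exact: measurable_error_sum.
have l0 : 0 <= a / 4 by rewrite divr_ge0// ltW.
apply: (le_trans (exp_markov P _ mS l0)).
apply: le_trans (lee_wpmul2l _ (error_mgf_le T)) _;
  rewrite ?lee_fin ?expR_ge0//.
rewrite -expRD ler_expR le_eqVlt; apply/orP; left; apply/eqP.
by field; rewrite gt_eqF.
Qed.
End error_sum.

(** * Measurability of the iterates *)

Section matrix_measurability.
Context {R : realType} d {T : measurableType d} {m n : nat}.

(** [mx_measurable_wrt G] unfolds to this notion on [g_sigma_algebraType G]. *)
Definition entrywise_measurable (Y : T -> 'M[R]_(m, n)) : Prop :=
  forall i j, measurable_fun setT (fun w => Y w i j).

(** An open set of matrices is the union of the balls that it contains among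
    the countably many with rational centre and radius [1 / k.+1]; in the max
    norm the event that Y lies in such a ball is a finite intersection of
    events about single entries. *)
Lemma measurable_continuous_comp (f : 'M[R]_(m, n) -> R)
    (Y : T -> 'M[R]_(m, n)) :
  continuous f -> entrywise_measurable Y -> measurable_fun setT (f \o Y).
Proof.
move=> /continuousP cf mY.
apply: (measurability _ (RGenOpens.measurableE R)) => _ [_ [a [b ->] <-]].
rewrite setTI; set O := f @^-1` `]a, b[%classic.
have oO : open O by apply: cf; exact: interval_open.
pose ctr (c : 'M[rat]_(m, n) * nat) : 'M[R]_(m, n) := map_mx ratr c.1.
pose box (c : 'M[rat]_(m, n) * nat) : set T :=
  [set w | ball (ctr c) c.2.+1%:R^-1 (Y w)].
have mbox c : measurable (box c).
  have -> : box c = \bigcap_(ij in [set: 'I_m * 'I_n])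
      [set w | `|ctr c ij.1 ij.2 - Y w ij.1 ij.2| < c.2.+1%:R^-1].
    apply/seteqP; split => [w [_ h] [i j] _|w h] /=; first exact: h.
    by split=> [|i j]; [|exact: (h (i, j))].
  apply: fin_bigcap_measurable => [|[i j] _ /=]; first exact: finite_finset.
  have mh : measurable_fun setT (fun w => `|ctr c i j - Y w i j|).
    by apply: measurableT_comp => //; apply: measurable_funB.
  have -> : [set w | `|ctr c i j - Y w i j| < c.2.+1%:R^-1] =
      setT `&` (fun w => `|ctr c i j - Y w i j|) @^-1` `]-oo, c.2.+1%:R^-1[.
    by apply/seteqP; split => w /=; rewrite in_itv/=; [by []|by case].
  exact: mh.
(* the balls, enumerated by their codes; a code of no ball gives set0 *)
pose F k : set T := if unpickle k is Some c then
  (if pselect (ball (ctr c) c.2.+1%:R^-1 `<=` O) then box c else set0)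
  else set0.
have -> : (f \o Y) @^-1` `]a, b[ = \bigcup_k F k.
  apply/seteqP; split => [w /= fw|w [k _]]; last first.
    rewrite /F; case: unpickle => // c; case: pselect => //= cO cw.
    exact: cO.
  have /nbhs_ballP[e /= e0 eO] : nbhs (Y w) O by exact: open_nbhs_nbhs.
  have [k ke] : exists k : nat, k.+1%:R^-1 < e / 2.
    exists (Num.truncn (e / 2)^-1).
    by rewrite invf_plt ?posrE ?divr_gt0// truncnS_gt.
  have k0 : 0 < k.+1%:R^-1 :> R by rewrite invr_gt0.
  have hq i j : exists q : rat, `|ratr q - Y w i j| < k.+1%:R^-1.
    have Yk : Y w i j < Y w i j + k.+1%:R^-1 by rewrite ltrDl.
    have [q] := rat_in_itvoo Yk.
    rewrite in_itv/= => /andP[q1 q2]; exists q.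
    by rewrite gtr0_norm ?subr_gt0// ltrBlDl.
  pose q := \matrix_(i < m, j < n)
    xget 0 [set q : rat | `|ratr q - Y w i j| < k.+1%:R^-1].
  exists (pickle (q, k)) => //; rewrite /F pickleK.
  have qw i j : `|ratr (q i j) - Y w i j| < k.+1%:R^-1.
    by rewrite mxE; have := xgetPex 0 (hq i j); apply.
  case: pselect => [sub|nO] /=.
    by split => // i j; rewrite mxE; exact: qw.
  exfalso; apply: nO => z [k1 hz]; apply: eO; split => // i j.
  have h1 := qw i j; have := hz i j; rewrite /ctr /= mxE /ball /= => h2.
  have -> : Y w i j - z i j = (Y w i j - ratr (q i j)) + (ratr (q i j) - z i j).
    by rewrite addrA subrK.
  apply: le_lt_trans (ler_normD _ _) _; rewrite distrC.
  by rewrite (splitr e) ltrD//; [exact: lt_trans h1 ke|exact: lt_trans h2 ke].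
apply: bigcup_measurable => k _; rewrite /F; case: unpickle => [c|] //.
by case: pselect => cO /=; [exact: mbox|exact: measurable0].
Qed.
End matrix_measurability.

Section iteration_measurability.
Context {R : realType} d {T : measurableType d} {n : nat}.

Lemma measurable_dotv (u v : T -> 'cV[R]_n) :
  entrywise_measurable u -> entrywise_measurable v ->
  measurable_fun setT (fun w => dotv (u w) (v w)).
Proof. by move=> mu mv; apply: measurable_sum => i; apply: measurable_funM. Qed.

Lemma measurable_enorm (u : T -> 'cV[R]_n) :
  entrywise_measurable u -> measurable_fun setT (fun w => enorm (u w)).
Proof.
move=> mu; rewrite /enorm; apply: measurableT_comp; last exact: measurable_dotv.
apply: continuous_measurable_fun. exact: sqrt_continuous.
Qed.

Lemma entrywise_measurableB (u v : T -> 'cV[R]_n) :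
  entrywise_measurable u -> entrywise_measurable v ->
  entrywise_measurable (fun w => u w - v w).
Proof.
move=> mu mv i j; under eq_fun do rewrite !mxE.
exact: measurable_funB.
Qed.

Lemma entrywise_measurable_mulmx (H : T -> 'M[R]_n) (v : T -> 'cV[R]_n) :
  entrywise_measurable H -> entrywise_measurable v ->
  entrywise_measurable (fun w => H w *m v w).
Proof.
move=> mH mv i j; under eq_fun do rewrite mxE.
by apply: measurable_sum => k; apply: measurable_funM.
Qed.

Lemma measurable_grad (phi : 'cV[R]_n -> R) (L : R) (Y : T -> 'cV[R]_n) :
  C1_lipschitz_grad phi L -> entrywise_measurable Y ->
  entrywise_measurable (fun w => grad phi (Y w)).
Proof.
move=> [_ cg _] mY i j.
apply: (measurable_continuous_comp (f := fun x => grad phi x i j)) => // x.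
apply: (@continuous_comp _ _ _ (grad phi) (fun M : 'cV[R]_n => M i j) x (cg x)).
exact: coord_continuous.
Qed.

(** As the predicted decrease q is nonnegative, acceptance reads
    [0 < q] and [eta1 * q <= f - fplus + r], which avoids the quotient; phi
    itself cancels in q. *)
Lemma measurable_accepted (phi : 'cV[R]_n -> R) (eta1 r : R)
    (X G S : T -> 'cV[R]_n) (H : T -> 'M[R]_n) (F Fplus : T -> R) :
  entrywise_measurable G -> entrywise_measurable S -> entrywise_measurable H ->
  measurable_fun setT F -> measurable_fun setT Fplus ->
  (forall w, 0 <= pred_decrease phi (X w) (G w) (H w) (S w)) ->
  measurable_fun setT (fun w =>
    accepted phi eta1 r (X w) (G w) (H w) (S w) (F w) (Fplus w)).
Proof.
move=> mG mS mH mF mFp pred0.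
pose q w := - dotv (G w) (S w) - 2^-1 * dotv (H w *m S w) (S w).
have mq : measurable_fun setT q.
  apply: measurable_funB; first by apply: measurable_funN; exact: measurable_dotv.
  apply: measurable_funM => //; apply: measurable_dotv => //.
  exact: entrywise_measurable_mulmx.
rewrite (_ : (fun w => _) =
    (fun w => (0 < q w) && (eta1 * q w <= F w - Fplus w + r))); last first.
  apply/funext => w; rewrite /accepted; move: (pred0 w).
  rewrite pred_decreaseE -/(q w) le_eqVlt eq_sym => /predU1P[->|q0].
    by rewrite eqxx ltxx.
  by rewrite gt_eqF// q0 ler_pdivlMr.
apply: measurable_and; first exact: measurable_fun_ltr.
apply: measurable_fun_ler; first exact: measurable_funM.
by apply: measurable_funD => //; exact: measurable_funB.
Qed.

End iteration_measurability.

Lemma bigmin_nat_le {R : realType} (c : R) (F : nat -> R) (T k : nat) :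
  (k < T)%N -> \big[Num.min/c]_(0 <= i < T) F i <= F k.
Proof.
by move=> kT; rewrite big_mkord; exact: (bigmin_le c (Ordinal kT) (fun i => F i)).
Qed.

Lemma measurable_bigmin {R : realType} d {T : measurableType d} (c : T -> R)
    (F : nat -> T -> R) (s : seq nat) :
  measurable_fun setT c -> (forall k, measurable_fun setT (F k)) ->
  measurable_fun setT (fun w => \big[Num.min/c w]_(i <- s) F i w).
Proof.
move=> mc mF; elim: s => [|k s IH]; first by under eq_fun do rewrite big_nil.
under eq_fun do rewrite big_cons.
exact: measurable_minr.
Qed.

Section process_measurability.
Context {R : realType} {n : nat} d {Omega : measurableType d}.
Variables (phi : 'cV[R]_n -> R) (x0 : 'cV[R]_n).
Variables (delta0 eta1 eta2 gamma r kfcd kbhm : R).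
Hypotheses (hdelta0 : 0 < delta0) (hgamma : 0 < gamma < 1).
Hypotheses (hkfcd : 0 < kfcd <= 1) (hkbhm : 0 < kbhm).
Variables (A A' : nat -> set (set Omega)).
Hypothesis AA' : forall k, <<s A k >> `<=` <<s A' k >>.
Hypothesis A'A : forall k, <<s A' k >> `<=` <<s A k.+1 >>.
Variables (X S G : nat -> Omega -> 'cV[R]_n) (H : nat -> Omega -> 'M[R]_n).
Variables (F Fplus Delta : nat -> Omega -> R).
Hypothesis hrun : forall w,
  trust_region_run phi x0 delta0 eta1 eta2 gamma r kfcd kbhm
    (fun k => X k w) (fun k => S k w) (fun k => G k w) (fun k => H k w)
    (fun k => F k w) (fun k => Fplus k w) (fun k => Delta k w).
Hypothesis mG : forall k, mx_measurable_wrt (A' k) (G k).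
Hypothesis mH : forall k, mx_measurable_wrt (A' k) (H k).
Hypothesis mXS : forall k, mx_measurable_wrt (A' k) (fun w => X k w + S k w).
Hypothesis mF : forall k, measurable_wrt (A k.+1) (F k).
Hypothesis mFplus : forall k, measurable_wrt (A k.+1) (Fplus k).

Lemma mx_measurable_wrt_sub (m p : nat) (B C : set (set Omega))
    (Y : Omega -> 'M[R]_(m, p)) :
  <<s B >> `<=` <<s C >> -> mx_measurable_wrt B Y -> mx_measurable_wrt C Y.
Proof. by move=> BC mY i j; exact: measurable_wrt_sub BC (mY i j). Qed.

Lemma iterates_measurable k :
  mx_measurable_wrt (A k) (X k) /\ measurable_wrt (A k) (Delta k).
Proof.
elim: k => [|k [mX mD]].
  split.
    move=> i j; under eq_fun do rewrite (run_x0 (hrun _)).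
    exact: measurable_cst.
  rewrite (_ : Delta 0%N = cst delta0); first exact: measurable_cst.
  by apply/funext => w; exact: run_delta0 (hrun w).
pose U := g_sigma_algebraType (A k.+1).
have AA k' : <<s A k' >> `<=` <<s A k'.+1 >> by move=> B /AA'; exact: A'A.
have mX' := mx_measurable_wrt_sub (@AA k) mX.
have mD' := measurable_wrt_sub (@AA k) mD.
have mG' := mx_measurable_wrt_sub (@A'A k) (@mG k).
have mH' := mx_measurable_wrt_sub (@A'A k) (@mH k).
have mXS' := mx_measurable_wrt_sub (@A'A k) (@mXS k).
have mS' : mx_measurable_wrt (A k.+1) (S k).
  have -> : S k = (fun w => X k w + S k w - X k w).
    by apply/funext => w; rewrite addrC addKr.
  exact: (@entrywise_measurableB R _ U).
have mA := @measurable_accepted R _ U n phi eta1 r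
  (X k) (G k) (S k) (H k) (F k) (Fplus k) mG' mS' mH' (@mF k) (@mFplus k)
  (fun w => pred_decrease_ge0 hkfcd hkbhm
     (run_delta_gt0 hdelta0 hgamma (hrun w) k)
     (run_hess_bound (hrun w) k) (run_cauchy (hrun w) k)).
split.
  move=> i j; under eq_fun do rewrite (run_x (hrun _)).
  rewrite (_ : (fun w => _) = (fun w =>
      if accepted phi eta1 r (X k w) (G k w) (H k w) (S k w) (F k w) (Fplus k w)
      then (X k w + S k w) i j else X k w i j)); last first.
    by apply/funext => w; case: ifP.
  apply: (@measurable_fun_ifT _ _ U).
  - exact: mA.
  - exact: mXS'.
  - exact: mX'.
rewrite (_ : Delta k.+1 = fun w =>
    if accepted phi eta1 r (X k w) (G k w) (H k w) (S k w) (F k w) (Fplus k w)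
       && (eta2 * Delta k w <= enorm (G k w))
    then gamma^-1 * Delta k w else gamma * Delta k w); last first.
  by apply/funext => w; exact: run_delta (hrun w) k.
apply: (@measurable_fun_ifT _ _ U).
- apply: measurable_and => //; apply: measurable_fun_ler.
    exact: measurable_funM.
  exact: (@measurable_enorm R _ U).
- exact: measurable_funM.
- exact: measurable_funM.
Qed.

End process_measurability.

Section sigma_algebras.
Context d d0 d1 {Omega : measurableType d} {Xi0 : measurableType d0}
  {Xi1 : measurableType d1} {R : realType} (P : probability Omega R).
Variables (xi1 : nat -> {RV P >-> Xi1}) (xi0 xi0plus : nat -> {RV P >-> Xi0}).

Let past_ := past xi1 xi0 xi0plus.
Let past_model_ := past_model xi1 xi0 xi0plus.

Lemma events_of_measurable d' (Xi : measurableType d') (xi : {RV P >-> Xi}) :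
  events_of xi `<=` measurable.
Proof. by move=> _ [A mA <-]; exact: measurable_funPT. Qed.

Lemma past_model_measurable k : <<s past_model_ k >> `<=` measurable.
Proof.
apply: smallest_sub; first exact: sigma_algebra_measurable.
by move=> A [[i _ [[]|]]|]; exact: events_of_measurable.
Qed.

Lemma past_sub_past_model k : <<s past_ k >> `<=` <<s past_model_ k >>.
Proof. by apply: sub_sigma_algebra2 => A ?; left. Qed.

Lemma past_measurable k : <<s past_ k >> `<=` measurable.
Proof. by move=> A /past_sub_past_model; exact: past_model_measurable. Qed.

Lemma past_model_sub_past k : <<s past_model_ k >> `<=` <<s past_ k.+1 >>.
Proof.
apply: sub_sigma_algebra2 => A [[i /= ik Ai]|Ak].
  by exists i => //=; exact: ltnW.
by exists k => //=; left; left.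
Qed.

Lemma past_incr k : <<s past_ k >> `<=` <<s past_ k.+1 >>.
Proof. by move=> A /past_sub_past_model; exact: past_model_sub_past. Qed.

End sigma_algebras.

(** * Assembling the bounds *)

Theorem theorem4p18 (R : realType) (n : nat)
  (* objective function *)
  (phi : 'cV[R]_n -> R) (L1 phihat : R)
  (hL1 : 0 <= L1) (hphi : C1_lipschitz_grad phi L1)
  (hphihat : forall x, phihat <= phi x)
  (* inputs and constants of the algorithm and of the oracles *)
  (x0 : 'cV[R]_n) (delta0 eta1 eta2 gamma r kfcd kbhm : R)
  (epsf a epsg keg p1 : R)
  (hdelta0 : 0 < delta0) (heta1 : 0 < eta1 < 1) (heta2 : 0 < eta2)
  (hgamma : 0 < gamma < 1) (hr : 0 < r)
  (hkfcd : 0 < kfcd <= 1) (hkbhm : 0 < kbhm)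
  (hepsf : 0 <= epsf) (ha : 0 < a) (hepsg : 0 <= epsg) (hkeg : 0 <= keg)
  (hp1 : 2^-1 <= p1 <= 1) (hrepsf : 2 * epsf <= r)
  (* probability space, oracles and their randomness *)
  (d d0 d1 : measure_display) (Omega : measurableType d)
  (Xi0 : measurableType d0) (Xi1 : measurableType d1) (P : probability Omega R)
  (oracle0 : 'cV[R]_n -> Xi0 -> R)
  (oracle1 : R -> R -> 'cV[R]_n -> Xi1 -> 'cV[R]_n)
  (xi1 : nat -> {RV P >-> Xi1}) (xi0 xi0plus : nat -> {RV P >-> Xi0})
  (* the process generated by the algorithm *)
  (X S : nat -> Omega -> 'cV[R]_n) (H : nat -> Omega -> 'M[R]_n)
  (Delta : nat -> Omega -> R) :
  let G k w := oracle1 (Delta k w) p1 (X k w) (xi1 k w) in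
  let Xplus k w : 'cV[R]_n := X k w + S k w in
  let F k w := oracle0 (X k w) (xi0 k w) in
  let Fplus k w := oracle0 (Xplus k w) (xi0plus k w) in
  let past_ := past xi1 xi0 xi0plus in
  let past_model_ := past_model xi1 xi0 xi0plus in
  forall
  (hrun : forall w,
    trust_region_run phi x0 delta0 eta1 eta2 gamma r kfcd kbhm
      (fun k => X k w) (fun k => S k w) (fun k => G k w) (fun k => H k w)
      (fun k => F k w) (fun k => Fplus k w) (fun k => Delta k w))
  (* measurability of the data of iteration k *)
  (hmG : forall k, mx_measurable_wrt (past_model_ k) (G k))
  (hmH : forall k, mx_measurable_wrt (past_model_ k) (H k))
  (hmXplus : forall k, mx_measurable_wrt (past_model_ k) (Xplus k))
  (hmF : forall k, measurable_wrt (past_ k.+1) (F k))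
  (hmFplus : forall k, measurable_wrt (past_ k.+1) (Fplus k))
  (* oracle guarantees, conditionally on the past *)
  (horacle1 : forall k, cond_prob_ge P (past_ k)
    [set w | enorm (G k w - grad phi (X k w)) <= keg * Delta k w + epsg] p1)
  (horacle0 : forall k, subexp_error P a epsf (past_model_ k)
    (fun w => F k w - phi (X k w)))
  (horacle0plus : forall k, subexp_error P a epsf (past_model_ k)
    (fun w => Fplus k w - phi (Xplus k w))),
  let p0 : R := 1 - 2 * expR (a * (epsf - r / 2)) in
  let C1 : R := const1 L1 eta1 eta2 kfcd kbhm keg in
  let C2 : R := const2 L1 eta1 eta2 kfcd kbhm keg in
  let C3 : R := const3 eta1 eta2 kfcd kbhm in
  forall (eps : R)
  (heps : Num.sqrt ((4 * epsf + 8 / a + 2 * r)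
                     / (C3 * gamma ^+ 2 * C1 ^+ 2 * (2 * p0 + 2 * p1 - 3)))
          + C2 / C1 * epsg < eps)
  (ph0 ph1 : R) (hph0 : ph0 <= p0) (hph1 : ph1 <= p1),
  let h : R := C3 * gamma ^+ 2 * (C1 * eps - C2 * epsg) ^+ 2 in
  forall
  (hph : ph0 + ph1 \in `]3 / 2 + (2 * epsf + 4 / a + r) / h, p0 + p1])
  (t : R) (ht : 0 <= t) (T : nat) (hT0 : (0 < T)%N)
  (hT : (ph0 + ph1 - 3 / 2 - (2 * epsf + 4 / a + r) / h)^-1
        * ((phi x0 - phihat + t) / h
           + 2^-1 * logb gamma
               (Num.min ((C1 * eps - C2 * epsg) / delta0)
                        (delta0 / (C1 * enorm (grad phi x0) - C2 * epsg)))
           + 2^-1)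
        <= T%:R),
  ((1 - expR (- ((1 - ph1 / p1) ^+ 2 / 2 * T%:R))
      - expR (- ((1 - ph0 / p0) ^+ 2 / 2 * T%:R))
      - expR (- (a / 4 * t)))%:E
   <= P [set w | ((\big[Num.min/enorm (grad phi (X 0%N w))]_(0 <= k < T)
                      enorm (grad phi (X k w))) <= eps)%R])%E.
Proof.
move=> G Xplus F Fplus past_ past_model_ hrun hmG hmH hmXplus hmF hmFplus
  horacle1 horacle0 horacle0plus p0 C1 C2 C3 eps heps ph0 ph1 hph0 hph1 h hph
  t ht T hT0 hT.
have /andP[g0 g1] := hgamma; have /andP[p12 p11] := hp1.
have C1_gt0 : 0 < C1 by exact: (const1_gt0 (L1 := L1)).
have C3_gt0 : 0 < C3 by exact: const3_gt0.
pose Db := C1 * eps - C2 * epsg.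
have Db0 : 0 < Db.
  have : C2 / C1 * epsg < eps.
    by apply: le_lt_trans heps; rewrite lerDr sqrtr_ge0.
  by rewrite /Db subr_gt0 mulrAC ltr_pdivrMr// (mulrC eps).
have h0 : 0 < h by rewrite /h mulr_gt0 ?exprn_gt0// mulr_gt0 ?exprn_gt0.
have noise0 : 0 <= (2 * epsf + 4 / a + r) / h.
  have a4 : 0 <= 4 / a by rewrite divr_ge0// ltW.
  by rewrite divr_ge0 ?(ltW h0)//; lra.
move: hph; rewrite in_itv/= => /andP[hphl hphr].
pose c := ph0 + ph1 - 3 / 2 - (2 * epsf + 4 / a + r) / h.
have c0 : 0 < c by rewrite /c; lra.
have p02 : 2^-1 <= p0 <= 1.
  apply/andP; split; first lra.
  by rewrite /p0 lerBlDr lerDl mulr_ge0 ?expR_ge0.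
have mP k : <<s past_ k >> `<=` measurable by exact: past_measurable.
have mPM k : <<s past_model_ k >> `<=` measurable.
  exact: past_model_measurable.
have P_PM k : <<s past_ k >> `<=` <<s past_model_ k >>.
  exact: past_sub_past_model.
have PM_P k : <<s past_model_ k >> `<=` <<s past_ k.+1 >>.
  exact: past_model_sub_past.
have P_P k : <<s past_ k >> `<=` <<s past_ k.+1 >> by exact: past_incr.
have mXD := iterates_measurable hdelta0 hgamma hkfcd hkbhm P_PM PM_P hrun
  hmG hmH hmXplus hmF hmFplus.
have mX k := (mXD k).1.
have mD k := (mXD k).2.
have cphi : continuous phi.
  by have [dphi _ _] := hphi; move=> x; exact: differentiable_continuous.
pose E k w := `|F k w - phi (X k w)|.
pose E' k w := `|Fplus k w - phi (Xplus k w)|.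
have mE k : measurable_wrt (past_ k.+1) (E k).
  apply: (measurableT_comp (@normr_measurable _ _)) => //.
  apply: measurable_funB; first exact: hmF.
  apply: (@measurable_continuous_comp R _
    (g_sigma_algebraType (past_ k.+1))) => //.
  exact: mx_measurable_wrt_sub (@P_P k) (mX k).
have mE' k : measurable_wrt (past_ k.+1) (E' k).
  apply: (measurableT_comp (@normr_measurable _ _)) => //.
  apply: measurable_funB; first exact: hmFplus.
  apply: (@measurable_continuous_comp R _
    (g_sigma_algebraType (past_ k.+1))) => //.
  exact: mx_measurable_wrt_sub (@PM_P k) (hmXplus k).
have tailE k u A : 0 <= u -> <<s past_model_ k >> A ->
    (P ([set w | (u < E k w)%R] `&` A) <= (expR (a * (epsf - u)))%:E * P A)%E.
  move=> u0 GA; apply: (cond_prob_le_measure (@mPM k)) GA; first exact: expR_ge0.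
  exact: horacle0.
have tailE' k u A : 0 <= u -> <<s past_model_ k >> A ->
    (P ([set w | (u < E' k w)%R] `&` A) <= (expR (a * (epsf - u)))%:E * P A)%E.
  move=> u0 GA; apply: (cond_prob_le_measure (@mPM k)) GA; first exact: expR_ge0.
  exact: horacle0plus.
pose B1 k :=
  ~` [set w | enorm (G k w - grad phi (X k w)) <= keg * Delta k w + epsg].
have GB1 k : <<s past_ k.+1 >> (B1 k).
  pose U := g_sigma_algebraType (past_ k.+1).
  have mL : measurable_fun [set: U] (fun w : U =>
      enorm (G k w - grad phi (X k w)) <= keg * Delta k w + epsg).
    apply: measurable_fun_ler.
      apply: (@measurable_enorm R _ U); apply: entrywise_measurableB.
        exact: mx_measurable_wrt_sub (@PM_P k) (hmG k).
      apply: (measurable_grad hphi); exact: mx_measurable_wrt_sub (@P_P k) (mX k).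
    apply: measurable_funD => //; apply: measurable_funM => //.
    exact: measurable_wrt_sub (@P_P k) (mD k).
  have := mL measurableT [set false] I; rewrite setTI.
  suff -> : (fun w : U => enorm (G k w - grad phi (X k w)) <=
      keg * Delta k w + epsg) @^-1` [set false] = B1 k by [].
  by apply/seteqP; split => w /= => [/negbT/negP|/negP/negbTE].
have PB1 k A : <<s past_ k >> A -> (P (B1 k `&` A) <= (1 - p1)%:E * P A)%E.
  apply: (cond_prob_ge_measureC (@mP k)); [lra| |exact: horacle1].
  rewrite -(setCK [set w | _ <= _]); apply: measurableC.
  exact: (mP k.+1 _ (GB1 k)).
have tail1 := count_tail T mP P_P hp1 hph1 GB1 PB1.
pose B0 k := [set w | r < E k w + E' k w].
have GB0 k : <<s past_ k.+1 >> (B0 k).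
  apply: (@measurable_gt_set _ (g_sigma_algebraType (past_ k.+1)) R).
  by apply: measurable_funD; [exact: mE|exact: mE'].
have mEO k : measurable_fun setT (E k).
  by apply: (measurable_fun_subalgebra (@mP k.+1)); exact: mE.
have mEO' k : measurable_fun setT (E' k).
  by apply: (measurable_fun_subalgebra (@mP k.+1)); exact: mE'.
have PB0 k A : <<s past_ k >> A -> (P (B0 k `&` A) <= (1 - p0)%:E * P A)%E.
  move=> /P_PM; rewrite /p0 subKr.
  exact: (error_pair_le (@mPM k) (ltW hr) (mEO k) (mEO' k) (tailE k) (tailE' k)).
have tail0 := count_tail T mP P_P p02 hph0 GB0 PB0.
have tail2 := error_sum_tail mP mPM P_PM PM_P ha hepsf mE mE' tailE tailE' T t.
move: tail1 tail0 tail2.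
set bad1 := [set w | _]; set bad0 := [set w | _]; set bad2 := [set w | _].
move=> tail1 tail0 tail2.
set good := [set w | _].
have mcount (B : nat -> set Omega) : (forall k, <<s past_ k.+1 >> (B k)) ->
    measurable_fun setT (fun w => \sum_(k < T) \1_(B k) w : R).
  move=> GB; apply: measurable_sum => k; apply: measurable_indic.
  exact: (mP k.+1 _ (GB k)).
have mbad1 : measurable bad1 by apply: measurable_gt_set; exact: mcount.
have mbad0 : measurable bad0 by apply: measurable_gt_set; exact: mcount.
have mbad2 : measurable bad2.
  by apply: measurable_gt_set; apply: measurable_sum => k; exact: measurable_funD.
have mgrad k : measurable_fun setT (fun w => enorm (grad phi (X k w))).
  apply: measurable_enorm; apply: (measurable_grad hphi) => i j.
  by apply: (measurable_fun_subalgebra (@mP k)); exact: mX.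
have mgood : measurable good.
  have := measurable_bigmin (index_iota 0 T) (mgrad 0%N) mgrad.
  have -> : good = setT `&` (fun w =>
      \big[Num.min/enorm (grad phi (X 0%N w))]_(k <- index_iota 0 T)
        enorm (grad phi (X k w))) @^-1` `]-oo, eps].
    by apply/seteqP; split => w /=; rewrite in_itv/=; [by []|by case].
  by apply.
have key : ~` good `<=` bad1 `|` bad0 `|` bad2.
  move=> w ngood; apply: contrapT => nbad; apply: ngood.
  have n1 : \sum_(k < T) \1_(B1 k) w <= (1 - ph1) * T%:R.
    by rewrite leNgt; apply/negP => b; apply: nbad; left; left.
  have n0 : \sum_(k < T) \1_(B0 k) w <= (1 - ph0) * T%:R.
    by rewrite leNgt; apply/negP => b; apply: nbad; left; right.
  have n2 : \sum_(k < T) (E k w + E' k w) <= T%:R * (2 * epsf + 4 / a) + t.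
    by rewrite leNgt; apply/negP => b; apply: nbad; right.
  have [||k kT le_eps] := run_reaches_accuracy hL1 hphi hphihat hdelta0 heta1
    heta2 hgamma hkfcd hkbhm hepsg hkeg (ltW hr) (hrun w) Db0 hT0 c0 hT _ _ n2.
  - apply: le_trans n1; apply: ler_sum => k _.
    by rewrite indicE in_setC mem_setE.
  - apply: le_trans n0; apply: ler_sum => k _.
    by rewrite indicE mem_setE -ltNge.
  apply: le_trans le_eps.
  exact: (bigmin_nat_le _ (fun k => enorm (grad phi (X k w))) kT).
have P_good : P good = (1 - P (~` good))%E.
  by rewrite -probability_setC ?setCK//; exact: measurableC.
rewrite P_good.
have Pbad : (P (~` good) <= (expR (- ((1 - ph1 / p1) ^+ 2 / 2 * T%:R)) +
    expR (- ((1 - ph0 / p0) ^+ 2 / 2 * T%:R)) + expR (- (a / 4 * t)))%:E)%E.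
  apply: (@le_trans _ _ (P (bad1 `|` bad0 `|` bad2))).
    rewrite le_measure ?inE//; first exact: measurableC.
    by apply: measurableU => //; exact: measurableU.
  apply: le_trans (measureU2 _ _ _) _ => //; first exact: measurableU.
  rewrite EFinD; apply: leeD => //.
  apply: le_trans (measureU2 _ _ _) _ => //.
  by rewrite EFinD; apply: leeD.
have mgc : measurable (~` good) by exact: measurableC.
move: Pbad; rewrite -(fineK (fin_num_measure P _ mgc)) -EFinB !lee_fin.
by clear; lra.
Qed.
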